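(* Let $\mathcal I$ be a semi-ideal on $2^\omega\notin\mathcal I$ containing the family $\overline{\mathcal N}$ of closed subsets of Haar measure zero in $2^\omega$. For any non-locally compact Polish group $X$ the semi-ideal $\mathcal{HI}$ has cofinality $\mathrm{cof}(\mathcal{HI})=\mathfrak c$.
   Context: All groups are Abelian, written additively; a Polish group is a topological group whose underlying space is Polish. A semi-ideal on a set is a nonempty family of subsets closed under taking subsets. The Haar measure on $2^\omega=\{0,1\}^\omega$ is the standard product measure. A subset $A$ of a Polish group $X$ is Haar-$\mathcal I$ if there is a continuous map $f:2^\omega\to X$ with $f^{-1}(A+x)\in\mathcal I$ for all $x\in X$; $\mathcal{HI}$ is the family of all subsets of Borel Haar-$\mathcal I$ sets in $X$. For a semi-ideal $\mathcal J$, $\mathrm{cof}(\mathcal J)=\min\{|\mathcal A|:\mathcal A\subset\mathcal J,\ \forall J\in\mathcal J\ \exists A\in\mathcal A\ (J\subset A)\}$. $\mathfrak c$ is the cardinality of the continuum. *)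

(* Defs.v *)
From HB Require Import structures.
From mathcomp Require Import all_boot all_order all_algebra.
From mathcomp Require Import all_classical all_reals all_analysis.
From mathcomp Require Import zify lra ring.

Set Implicit Arguments.
Unset Strict Implicit.
Unset Printing Implicit Defensive.

Import Order.TTheory GRing.Theory Num.Theory.
Import numFieldNormedType.Exports.

Local Open Scope classical_set_scope.
Local Open Scope card_scope.
Local Open Scope ring_scope.

Definition semi_ideal (T : Type) (J : set (set T)) : Prop :=
  J !=set0 /\ (forall A B : set T, A `<=` B -> J B -> J A).

Definition borel (T : topologicalType) : set (set T) := <<s @open T >>.

Definition separable (T : topologicalType) : Prop :=
  exists2 D : set T, countable D & dense D.

Definition is_metric (R : realType) (T : Type) (d : T -> T -> R) : Prop :=
  [/\ forall x y, d x y = 0 <-> x = y,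
      forall x y, d x y = d y x &
      forall x y z, d x z <= d x y + d y z].

Definition induces_topology (R : realType) (T : topologicalType)
    (d : T -> T -> R) : Prop :=
  forall (x : T) (A : set T),
    nbhs x A <-> exists2 e, 0 < e & [set y | d x y < e] `<=` A.

Definition complete_metric (R : realType) (T : topologicalType)
    (d : T -> T -> R) : Prop :=
  forall u : nat -> T,
    (forall e, 0 < e -> exists N, forall m n, (N <= m)%N -> (N <= n)%N ->
       d (u m) (u n) < e) ->
    exists l : T, u @ \oo --> l.

Definition polish (R : realType) (T : topologicalType) : Prop :=
  separable T /\
  exists d : T -> T -> R,
    [/\ is_metric d, induces_topology d & complete_metric d].

Notation cantor_borel := (g_sigma_algebraType (@open cantor_space)).

Definition cylinder (s : nat -> bool) (n : nat) : set cantor_space :=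
  [set x | forall i, (i < n)%N -> x i = s i].

(* The fair-coin product measure: a Borel measure on 2^omega is determined by
   its values on cylinders, so there is at most one such mu. *)
Definition is_coin_measure (R : realType)
    (mu : {measure set cantor_borel -> \bar R}) : Prop :=
  forall (s : nat -> bool) (n : nat), mu (cylinder s n) = (2^-1 ^+ n)%:E.

Section existence.
Variable R : realType.

Lemma cylinder_nbhs (x : cantor_space) (U : set cantor_space) :
  nbhs x U -> exists n, cylinder x n `<=` U.
Proof.
pose F : set_system cantor_space := filter_from [set: nat] (cylinder x).
have FF : Filter F.
  apply: filter_from_filter; first by exists 0%N.
  move=> i j _ _; exists (maxn i j) => // y xy; split=> k ki; apply: xy.
    by rewrite leq_max ki.
  by rewrite leq_max ki orbT.
suff /[apply] : F --> x by move=> [n _ nU]; exists n.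
apply/cvg_sup => i; apply/cvg_image; first by apply/seteqP; split=> // b _; exists (fun=> b).
move=> A /= Ai; exists (proj i @^-1` A).
  exists i.+1 => //= y yx /=; rewrite /proj (yx i (ltnSn i)).
  exact: nbhs_singleton Ai.
apply/seteqP; split=> [_ [y Ay <-]//|b Ab].
by exists (fun=> b).
Qed.

Lemma measurable_cylinder (s : nat -> bool) (n : nat) :
  measurable (cylinder s n : set cantor_borel).
Proof.
apply: sub_sigma_algebra; elim: n => [|n IH].
  by rewrite (_ : cylinder s 0 = setT); [exact: openT|exact/seteqP].
rewrite (_ : cylinder s n.+1 = cylinder s n `&` proj n @^-1` [set s n]).
  apply: openI => //.
  by apply: open_comp; [move=> x _; exact: proj_continuous|exact: discrete_open].
apply/seteqP; split=> [x xs|x [xs xn] i].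
  by split=> [i ni|]; apply: xs; [exact: ltnW|exact: ltnSn].
by rewrite ltnS leq_eqVlt => /orP[/eqP->|/xs].
Qed.

(* Binary expansion on [0, 1[, constantly 0 elsewhere. *)
Let digits (x : R) : cantor_borel :=
  fun n => (0 <= x < 1) && odd (Num.truncn (x * 2 ^+ n.+1)).

Fixpoint dyadic (s : nat -> bool) (n : nat) : nat :=
  if n is m.+1 then (s m + (dyadic s m).*2)%N else 0%N.

Lemma dyadic_lt s n : (dyadic s n < 2 ^ n)%N.
Proof. by elim: n => //= n; rewrite expnS; case: (s n); lia. Qed.

Lemma truncn_double (x : R) : 0 <= x -> (Num.truncn (x * 2))./2 = Num.truncn x.
Proof.
move=> x0; symmetry.
apply/eqP; rewrite truncn_eq//.
have /truncn_itv/andP[l u] : 0 <= x * 2 by lra.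
move: l u; set m := Num.truncn _ => l u.
have mE : m%:R = (odd m)%:R + 2 * (m./2)%:R :> R.
  by rewrite -{1}(odd_double_half m) -mul2n natrD natrM.
rewrite -[m.+1]addn1 -[m./2.+1]addn1 !natrD mE in u *.
by rewrite mE in l; move: l u; case: (odd m) => /= l u; apply/andP; split; lra.
Qed.

Lemma digits_cylinder s n (x : R) : 0 <= x < 1 ->
  cylinder s n (digits x) <-> Num.truncn (x * 2 ^+ n) = dyadic s n.
Proof.
move=> x01; rewrite /digits x01/=; case/andP: x01 => x0 x1.
elim: n => [|n IH].
  split=> // _ /=; apply/eqP; rewrite expr0 mulr1 truncn_eq// x0/=; lra.
have tE := odd_double_half (Num.truncn (x * 2 ^+ n.+1)).
have hE : (Num.truncn (x * 2 ^+ n.+1))./2 = Num.truncn (x * 2 ^+ n).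
  by rewrite exprSr mulrA truncn_double// mulr_ge0// exprn_ge0.
rewrite hE in tE; split.
  move=> c; rewrite -tE /=; have /IH-> : cylinder s n (fun n => odd (Num.truncn (x * 2 ^+ n.+1))).
    by move=> i ni; apply: c; rewrite ltnS ltnW.
  by have <- := c n (ltnSn n).
move=> /= E; move: tE; rewrite E => tE.
have o : odd (Num.truncn (x * 2 ^+ n.+1)) = s n.
  by rewrite E oddD odd_double addbF oddb.
have /IH c : Num.truncn (x * 2 ^+ n) = dyadic s n.
  by rewrite -hE E half_bit_double.
move=> i; rewrite ltnS leq_eqVlt => /orP[/eqP->|/c]//.
Qed.

Lemma digits_preimage s n :
  `[0, 1[%classic `&` digits @^-1` cylinder s n =
  `[(dyadic s n)%:R / 2 ^+ n, (dyadic s n).+1%:R / 2 ^+ n[%classic.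
Proof.
have p : 0 < 2 ^+ n :> R by rewrite exprn_gt0.
apply/seteqP; split=> [x [/= + c]|x /=]; rewrite !in_itv/=.
  move=> x01; move/(digits_cylinder s n x01) : c => tE.
  have /truncn_itv : 0 <= x * 2 ^+ n by case/andP: x01 => ? _; rewrite mulr_ge0// ltW.
  by rewrite tE ler_pdivrMr// ltr_pdivlMr.
rewrite ler_pdivrMr// ltr_pdivlMr// => dx.
have x01 : 0 <= x < 1.
  case/andP: dx => d1 d2; apply/andP; split.
    by rewrite -(pmulr_lge0 _ p) (le_trans _ d1).
  rewrite -(ltr_pM2r p) mul1r (lt_le_trans d2)//.
  by rewrite -natrX ler_nat dyadic_lt.
split=> //.
apply/(digits_cylinder s n x01)/eqP; rewrite truncn_eq//.
by case/andP: x01 => ? _; rewrite mulr_ge0// ltW.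
Qed.

Lemma measurable_digits_cylinder s n :
  measurable (digits @^-1` cylinder s n).
Proof.
rewrite -(setUIDK (digits @^-1` _) `[0, 1[%classic) setIC digits_preimage.
apply: measurableU; first exact: measurable_itv.
have [s0|s0] := pselect (cylinder s n (fun=> false)).
  rewrite (_ : _ `\` _ = ~` `[0, 1[%classic).
    by apply: measurableC; exact: measurable_itv.
  apply/seteqP; split=> [x []//|x x01]; split=> // i ni; rewrite -(s0 i ni) /digits.
  by move: x01; rewrite /= in_itv/= => /negP/negbTE->.
rewrite (_ : _ `\` _ = set0)//; apply/seteqP; split=> x //= [xs].
rewrite in_itv/= => /negP/negbTE x01; apply: s0 => i /xs <-.
by rewrite /digits x01.
Qed.

Lemma measurable_digits : measurable_fun [set: R] digits.
Proof.
apply: (@measurability _ _ _ cantor_borel _ _ (@open cantor_space)) => //.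
move=> _ [U oU <-]; rewrite setTI.
pose C (b : bitseq) := cylinder (nth false b) (size b).
have -> : U = \bigcup_b (C b `&` [set _ | C b `<=` U]).
  apply/seteqP; split=> [x Ux|x [b _ [bx /(_ _ bx)]]//].
  have [n nU] := cylinder_nbhs (open_nbhs_nbhs (conj oU Ux)).
  have CE : C (mkseq x n) = cylinder x n.
    by rewrite /C size_mkseq; apply/seteqP; split=> y yx i ni; rewrite yx// nth_mkseq.
  by exists (mkseq x n); rewrite //= CE.
rewrite preimage_bigcup; apply: countable_bigcupT_measurable => [|b].
  exact: countableP.
have [bU|bU] := pselect (C b `<=` U).
  rewrite (_ : _ `&` _ = C b); first exact: measurable_digits_cylinder.
  by apply/seteqP; split=> [x []|].
by rewrite (_ : _ `&` _ = set0) ?preimage_set0//; apply/seteqP; split=> x // [].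
Qed.

Let mI : measurable (`[0, 1[%classic : set R). Proof. exact: measurable_itv. Qed.

Let coin : {measure set cantor_borel -> \bar R} :=
  measure_function_pushforward__canonical__measure_function_Measure
    (mrestr (@lebesgue_measure R) mI) measurable_digits.

Lemma coin_measure_exists :
  exists mu : {measure set cantor_borel -> \bar R}, is_coin_measure mu.
Proof.
exists coin => s n; rewrite /coin/= /pushforward /mrestr setIC digits_preimage.
have p : 0 < 2 ^+ n :> R by rewrite exprn_gt0.
rewrite lebesgue_measure_itv/= lte_fin ltr_pM2r ?invr_gt0// ltr_nat ltnSn.
by rewrite -EFinB -mulrBl -natrB// subSnn mul1r exprVn.
Qed.

End existence.

(* Chosen, but well defined: see the uniqueness remark at is_coin_measure. *)
Definition haar_cantor (R : realType) : {measure set cantor_borel -> \bar R} :=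
  sval (cid (coin_measure_exists R)).

Lemma haar_cantor_coin (R : realType) : is_coin_measure (haar_cantor R).
Proof. exact: svalP. Qed.

Section haar_small.
Variable X : topologicalZmodType.
Implicit Types (I : set (set cantor_space)) (A : set X).

Definition haar_small I A : Prop :=
  exists f : cantor_space -> X, continuous f /\
    forall x : X, I (f @^-1` [set a + x | a in A]).

Definition haar_family I : set (set X) :=
  [set A | exists B, [/\ borel B, haar_small I B & A `<=` B]].

End haar_small.

Definition cofinal_in (T : Type) (J F : set (set T)) : Prop :=
  F `<=` J /\ forall A, J A -> exists2 B, F B & A `<=` B.

(* cof(J) = |K|: the minimum of the cardinals |F|, F cofinal in J, is |K|. *)
Definition cof_eq (T U : Type) (J : set (set T)) (K : set U) : Prop :=
  (exists F, cofinal_in J F /\ F #= K) /\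
  (forall F, cofinal_in J F -> K #<= F).

(* Main.v *)
Require Import Defs.
From mathcomp Require Import all_boot all_order all_algebra.
From mathcomp Require Import all_classical all_reals all_analysis.
From mathcomp Require Import wochoice.
From mathcomp Require Import zify lra.

(** The upper bound holds because the Borel small sets form a cofinal family, and
    Borel sets have well-founded codes, so that there are at most continuum many
    of them (borel_embeds).

    For the lower bound, a family of small sets fiber t, indexed by the points t
    of the Cantor space, is constructed.  Non-locally compact groups have room to
    translate all continuous images of the Cantor space so that they become
    separated from each other: there are maps ev c, for c in the Baire space,
    such that every continuous map psi from the Cantor space to the group is a
    translate of some ev c, while a fixed injective continuous map phi, however
    translated, meets the points ev c t, for a given t, at most once.  Both ev
    and phi are sums of series.  The terms of ev combine step functions, which
    approximate psi, with shifts chosen so as to escape from finitely many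
    translates of a smaller neighbourhood (thin_chain, term_clash,
    first_difference, ev_universal, fiber_phi).  The convergence of the series
    rests on the theorem of Klee that a Polish abelian group is complete for its
    group uniformity (cauchy_converges).  As closed null sets belong to the given
    semi-ideal, phi witnesses that the Borel set fiber t, which contains all the
    ev c t, is small.

    Let F be cofinal and let A be in F, contained in the small Borel set B, with
    witness f.  The set good A of the t for which B contains all the ev c t is
    coanalytic (borel_analytic).  If it had a perfect subset, there would be a
    continuous map q of the Cantor space that sends good A onto the whole space; then
    f composed with q is a translate of some ev c, and B contains a translate of
    the whole image of f, which contradicts the choice of f.  Hence good A has no
    perfect subset and has at most aleph_1 points.  The good sets cover the
    Cantor space, since every fiber t is contained in a member of F.

    It remains to count.  F is uncountable: points outside countably many small
    sets can be picked on well separated translates, and then they form a small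
    set.  So aleph_1 embeds in F, each good A embeds in F
    (coanalytic_perfect_set), and the continuum is a union of at most F sets
    which embed in F, so that it embeds in F because the square of an infinite
    type embeds in the type (square_embedding).  The perfect set theorem used here
    is the one for projections of closed sets of sequences over aleph_1
    (perfect_set), applied to rank functions of well-founded trees
    (coanalytic_suslin). *)

Set Implicit Arguments.
Unset Strict Implicit.
Unset Printing Implicit Defensive.

Local Open Scope classical_set_scope.

(** * Squares and finite sequences of infinite types *)

(** A matching that is maximal for inclusion exhausts one of the two sides,
    since otherwise one more pair could be added to it. *)
Lemma exhausting_matching (T U : Type) (A : set T) (B : set U) :
  exists G : set (T * U), [/\ forall a b, G (a, b) -> A a /\ B b,
    forall a b c, G (a, b) -> G (a, c) -> b = c,
    forall a c b, G (a, b) -> G (c, b) -> a = c &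
    (forall a, A a -> exists b, G (a, b)) \/ (forall b, B b -> exists a, G (a, b))].
Proof.
pose P (G : set (T * U)) := [/\ forall a b, G (a, b) -> A a /\ B b,
  forall a b c, G (a, b) -> G (a, c) -> b = c &
  forall a c b, G (a, b) -> G (c, b) -> a = c].
have [|G [[GAB Gf Gi] Gmax]] := @Zorn_bigcup _ P.
  move=> C CP Ctot; have both x y : (\bigcup_(X in C) X) x ->
      (\bigcup_(X in C) X) y -> exists2 X, C X & X x /\ X y.
    move=> [X CX Xx] [Y CY Yy].
    by case: (Ctot _ _ CX CY) => s; [exists Y|exists X] => //; split=> //; apply: s.
  split=> [a b [X /CP[XAB _ _] /XAB]//|a b c h1 h2|a c b h1 h2].
    by have [X /CP[_ Xf _] []] := both _ _ h1 h2; exact: Xf.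
  by have [X /CP[_ _ Xi] []] := both _ _ h1 h2; exact: Xi.
exists G; split=> //.
have [hA|hA] := pselect (forall a, A a -> exists b, G (a, b)); first by left.
right=> b Bb; apply: contrapT => hb.
move: hA => /existsNP[a /not_implyP[Aa /forallNP ha]].
apply: (Gmax (G `|` [set (a, b)])).
  split; first by move=> x; left.
  by move=> /(_ (a, b) (or_intror erefl)) /ha.
split=> [x y [/GAB//|[-> ->]]//|x y z|x z y].
  move=> [Gxy|[ex ->]] [Gxz|[ex' ->]] //; first exact: Gf Gxy Gxz.
    by case: (ha y); rewrite -ex'.
  by case: (ha z); rewrite -ex.
move=> [Gxy|[-> ey]] [Gzy|[-> ey']] //; first exact: Gi Gxy Gzy.
  by case: hb; exists x; rewrite -?ey'.
by case: hb; exists z; rewrite -?ey.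
Qed.

Lemma injection_dichotomy (T : Type) (A B : set T) :
  (exists f : T -> T, (forall a, A a -> B (f a)) /\
    forall a a', A a -> A a' -> f a = f a' -> a = a') \/
  (exists f : T -> T, (forall a, B a -> A (f a)) /\
    forall a a', B a -> B a' -> f a = f a' -> a = a').
Proof.
have [G [GAB Gf Gi [GA|GB]]] := exhausting_matching A B; [left|right].
  have /choice[f fP] : forall a, exists b, A a -> G (a, b).
    move=> a; have [/GA[b Gb]|nA] := pselect (A a); first by exists b.
    by exists a.
  exists f; split=> [a /fP/GAB[]//|a a' /fP h /fP h' e].
  by apply: (Gi _ _ (f a)) => //; rewrite e.
have /choice[f fP] : forall b, exists a, B b -> G (a, b).
  move=> a; have [/GB[b Gb]|nA] := pselect (B a); first by exists b.
  by exists a.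
exists f; split=> [a /fP/GAB[]//|a a' /fP h /fP h' e].
by apply: (Gf (f a)) => //; rewrite e.
Qed.

(** Take D maximal among the subsets carrying an injection of D * D into D that
    extends a fixed pairing of the integers.  If the complement of D embeds in
    D, then the whole type embeds in D.  Otherwise the complement contains a
    copy E of D, and the pairing extends to the union of D and E, because the
    three new quarters of its square all fit into E. *)
Lemma square_embedding (V : Type) (j : nat -> V) : injective j ->
  exists p : V * V -> V, injective p.
Proof.
move=> ji.
pose dom (G : set ((V * V) * V)) a := exists c, G ((a, a), c).
pose Q G := [/\ (forall a b c, G ((a, b), c) -> [/\ dom G a, dom G b & dom G c]),
  (forall a b, dom G a -> dom G b -> exists c, G ((a, b), c)),
  (forall p c c', G (p, c) -> G (p, c') -> c = c') &
  (forall p p' c, G (p, c) -> G (p', c) -> p = p')].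
pose G0 : set ((V * V) * V) :=
  [set x | exists m n, x = ((j m, j n), j (pickle (m, n)))].
have G0dom n : dom G0 (j n) by exists (j (pickle (n, n))), n, n.
(* The condition bears on G0 `|` G so that the empty chain has an upper bound. *)
have [|G [[Gd Gt Gf Gi] Gmax]] := @Zorn_bigcup _ (fun G => Q (G0 `|` G)).
  move=> C CP Ctot.
  have [->|[X0 CX0]] : C = set0 \/ C !=set0 by have [|/set0P] := eqVneq C set0; [left|right].
    rewrite bigcup_set0 setU0; split.
    - by move=> a b c [m [n [-> -> ->]]].
    - by move=> a b [c [m [_ [-> _ _]]]] [d [n [_ [-> _ _]]]]; eexists; exists m, n.
    - by move=> p c c' [m [n [-> ->]]] [m' [n' [/ji -> /ji -> ->]]].
    - move=> p p' c [m [n [-> ->]]] [m' [n' [-> /ji]]].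
      by move/(pcan_inj pickleK) => [-> ->].
  have E : G0 `|` \bigcup_(X in C) X = \bigcup_(X in C) (G0 `|` X).
    rewrite eqEsubset; split=> x.
      by case=> [gx|[X CX Xx]]; [exists X0 => //; left|exists X => //; right].
    by case=> X CX [?|?]; [left|right; exists X].
  rewrite E.
  have both x y : (\bigcup_(X in C) (G0 `|` X)) x ->
      (\bigcup_(X in C) (G0 `|` X)) y -> exists2 X, C X & (G0 `|` X) x /\ (G0 `|` X) y.
    move=> [X CX Xx] [Y CY Yy].
    case: (Ctot _ _ CX CY) => s; [exists Y|exists X] => //; split=> //.
      by case: Xx => [|/s]; [left|right].
    by case: Yy => [|/s]; [left|right].
  have sub X : C X -> G0 `|` X `<=` \bigcup_(X in C) (G0 `|` X).
    by move=> CX x Xx; exists X.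
  have dsub X : C X -> dom (G0 `|` X) `<=` dom (\bigcup_(X in C) (G0 `|` X)).
    by move=> /sub s a [c /s]; exists c.
  split.
  - move=> a b c [X CX Xc]; have [Xd _ _ _] := CP X CX.
    by have [? ? ?] := Xd _ _ _ Xc; split; exact: (dsub _ CX).
  - move=> a b [c h1] [d h2]; have [X CX [Xa Xb]] := both _ _ h1 h2.
    have [_ Xt _ _] := CP X CX; have [||e Xe] := Xt a b; [by exists c|by exists d|].
    by exists e; exact: (sub _ CX).
  - move=> p c c' h1 h2; have [X CX [Xa Xb]] := both _ _ h1 h2.
    by have [_ _ Xf _] := CP X CX; exact: Xf Xa Xb.
  - move=> p p' c h1 h2; have [X CX [Xa Xb]] := both _ _ h1 h2.
    by have [_ _ _ Xi] := CP X CX; exact: Xi Xa Xb.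
set H := G0 `|` G in Gd Gt Gf Gi.
pose D := dom H.
have jD n : D (j n) by have [c Gc] := G0dom n; exists c; left.
have /choice[f0 f0P] : forall p : V * V, exists c, D p.1 -> D p.2 -> H (p, c).
  move=> [a b]; have [[da db]|n] := pselect (D a /\ D b).
    by have [c Hc] := Gt _ _ da db; exists c.
  by exists a => /= ? ?; case: n.
pose f a b := f0 (a, b).
have fH a b : D a -> D b -> H ((a, b), f a b) by move=> da db; exact: f0P.
have fD a b : D a -> D b -> D (f a b).
  by move=> da db; case: (Gd _ _ _ (fH _ _ da db)).
have fI a b a' b' : D a -> D b -> D a' -> D b' -> f a b = f a' b' -> a = a' /\ b = b'.
  move=> da db da' db' e; have := fH _ _ da' db'; rewrite -e => h.
  by have [-> ->] := Gi _ _ _ (fH _ _ da db) h.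
have [[h [hD hI]]|[h [hD hI]]] := injection_dichotomy (~` D) D.
  pose g v := if pselect (D v) then f (j 0) v else f (j 1) (h v).
  have gD v : D (g v) by rewrite /g; case: pselect => dv; apply: fD => //; exact: hD.
  have gI : injective g.
    move=> u v; rewrite /g; case: pselect => du; case: pselect => dv.
    - by move/fI => [] //.
    - by move/fI => [] //; [exact: hD|move/ji].
    - by move/fI => [] //; [exact: hD|move/ji].
    - by move/fI => [] //; [exact: hD|exact: hD|move=> _ /hI; apply].
  exists (fun p => f (g p.1) (g p.2)) => -[a b] [a' b'] /= /fI[] //.
  by move=> /gI -> /gI ->.
exfalso.
pose E v := exists2 a, D a & v = h a.
have nDE v : D v -> E v -> False by move=> dv [a da e]; case: (hD a da); rewrite -e.
(* r identifies the copy E of D with D, and tag tells the three new quarters apart. *)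
pose r v := if pselect (D v) then v else
  if pselect (E v) is left e then s2val (cid2 e) else v.
have rD v : D v -> r v = v by rewrite /r; case: pselect.
have rh a : D a -> r (h a) = a.
  move=> da; rewrite /r; case: pselect => [/nDE[]|nd]; first by exists a.
  case: pselect => [e|[]]; last by exists a.
  by case: cid2 => b db /= /hI ->.
have rDE v : D v \/ E v -> D (r v).
  by case=> [dv|[a da ->]]; [rewrite rD|rewrite rh].
pose tag (x y : V) := j (if pselect (D x) then 1 else if pselect (D y) then 0 else 2).
pose code x y := f (f (tag x y) (r x)) (r y).
have DE_inj x y x' y' : D x \/ E x -> D y \/ E y -> D x' \/ E x' -> D y' \/ E y' ->
   ~ (D x /\ D y) -> ~ (D x' /\ D y') ->
   code x y = code x' y' -> x = x' /\ y = y'.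
  move=> hx hy hx' hy' n n'; have [dx dy dx' dy'] := And4 (rDE _ hx) (rDE _ hy) (rDE _ hx') (rDE _ hy').
  rewrite /code => /fI[] //; [by apply: fD; rewrite /tag|by apply: fD; rewrite /tag|].
  move=> /fI[] // ; rewrite ?/tag //.
  have same v v' : (D v <-> D v') -> D v \/ E v -> D v' \/ E v' -> r v = r v' -> v = v'.
    move=> i [dv|[a da e]] hv'; first by rewrite !rD -?i.
    have nv : ~ D v by rewrite e; exact: hD.
    case: hv' => [/i//|[a' da' e']]; by rewrite e e' !rh // => ->.
  move=> /ji te rx ry; split; apply: same => //; move: te;
  by do 4! case: pselect => //; tauto.
pose N : set ((V * V) * V) := [set p | [/\ D p.1.1 \/ E p.1.1, D p.1.2 \/ E p.1.2,
   ~ (D p.1.1 /\ D p.1.2) & p.2 = h (code p.1.1 p.1.2)]].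
have codeD x y : D x \/ E x -> D y \/ E y -> D (code x y).
  by move=> hx hy; apply: (fD _ _); [apply: fD; rewrite /tag //|]; exact: rDE.
have NE p c : N (p, c) -> E c by move=> [hx hy _ /= ->]; exists (code p.1 p.2) => //; exact: codeD.
have domU v : dom (H `|` N) v <-> D v \/ E v.
  split; first by case=> c [hc|[]//]; left; exists c.
  case=> [[c hc]|ev]; first by exists c; left.
  exists (h (code v v)); right; split => //=; [by right|by right|].
  by case=> d _; exact: nDE d ev.
apply: (Gmax (G `|` N)).
  split; first by move=> x; left.
  have ej : E (h (j 0)) by exists (j 0).
  have nj : N ((h (j 0), h (j 0)), h (code (h (j 0)) (h (j 0)))).
    by split => //=; [right|right|case=> d _; exact: nDE d ej].
  move=> /(_ _ (or_intror nj)) gn; apply: (nDE (h (j 0))) => //.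
  by case: (Gd _ _ _ (or_intror gn)).
rewrite setUA -/H; split.
- move=> a b c [/Gd[da db dc]|n]; first by split; apply/domU; left.
  split; apply/domU; [by case: n|by case: n|].
  by right; apply: NE n.
- move=> a b /domU ha /domU hb; have [[da db]|n] := pselect (D a /\ D b).
    by have [c hc] := Gt _ _ da db; exists c; left.
  by exists (h (code a b)); right.
- move=> [a b] c c' [hc|[? ? n /= ->]] [hc'|[? ? n' /= ->]] //; first exact: Gf hc hc'.
    by case: n'; case: (Gd _ _ _ hc).
  by case: n; case: (Gd _ _ _ hc').
- move=> [a b] [a' b'] c [hc|n] [hc'|n']; first exact: Gi hc hc'.
  + by exfalso; apply: (nDE c); [case: (Gd _ _ _ hc)|exact: NE n'].
  + by exfalso; apply: (nDE c); [case: (Gd _ _ _ hc')|exact: NE n].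
  + case: n n' => /= ha hb nab -> [ha' hb' nab' /= /hI e].
    by have [||-> ->] := DE_inj _ _ _ _ ha hb ha' hb' nab nab' (e _ _); try exact: codeD.
Qed.

Lemma seq_embedding (V : Type) (j : nat -> V) : injective j ->
  exists p : seq V -> V, injective p.
Proof.
move=> ji; have [p pI] := square_embedding ji.
pose e := foldr (fun x y => p (x, y)) (j 0).
exists (fun s => p (j (size s), e s)) => s s' /pI[/ji].
elim: s s' => [|x s IH] [|x' s'] //= [/IH h] /pI[-> /h ->//].
Qed.

(** * Perfect subsets of projections of closed sets *)

Definition agree (A : Type) (n : nat) (s t : nat -> A) := forall i, (i < n)%N -> s i = t i.

Lemma agreeW (A : Type) m n (s t : nat -> A) : (m <= n)%N -> agree n s t -> agree m s t.
Proof. by move=> mn h i im; apply: h; exact: leq_trans mn. Qed.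

Lemma agree_sym (A : Type) n (s t : nat -> A) : agree n s t -> agree n t s.
Proof. by move=> h i /h. Qed.

(** Closedness for the product topologies on sequences, expressed with finite
    prefixes. *)
Definition seq_closed (A B : Type) (E : (nat -> A) -> (nat -> B) -> Prop) :=
  forall s t, (forall n, exists s' t', [/\ agree n s s', agree n t t' & E s' t']) -> E s t.

Definition embeds (T : Type) (A : set T) (V : Type) :=
  exists f : T -> V, forall x y, A x -> A y -> f x = f y -> x = y.

Section embeds.
Variables (V : Type) (j : nat -> V).
Hypothesis j_inj : injective j.

Lemma embeds_sub T (A B : set T) : A `<=` B -> embeds B V -> embeds A V.
Proof. by move=> AB [f fB]; exists f => x y /AB Bx /AB By; exact: fB. Qed.

Lemma embeds_bigcup I T (A : I -> set T) (g : I -> V) : injective g ->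
  (forall i, embeds (A i) V) -> embeds (\bigcup_i A i) V.
Proof.
move=> gI /choice[f fA]; have [p pI] := square_embedding j_inj.
have /choice[h hP] : forall t, exists v, (\bigcup_i A i) t -> exists2 i, A i t & v = p (g i, f i t).
  move=> t; have [[i _ Ait]|n] := pselect ((\bigcup_i A i) t); last by exists (j 0).
  by exists (p (g i, f i t)) => _; exists i.
exists h => x y /hP[i Aix ->] /hP[i' Aiy ->] /pI[/gI ei].
by rewrite -ei in Aiy * => /fA; apply.
Qed.

Lemma embeds_subsingleton T (A : set T) : (forall x y, A x -> A y -> x = y) -> embeds A V.
Proof. by move=> h; exists (fun=> j 0) => x y Ax Ay _; exact: h. Qed.

End embeds.

(** The derivative argument for projections of closed sets of sequences over an
    arbitrary alphabet W.  A node is a finite prefix of a pair (t, r) with R t r;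
    it is large if the set of the t passing through it does not embed in V.
    The nodes embed in V, so discarding the small ones loses a set that embeds
    in V, and what remains branches everywhere. *)
Section perfect_set.
Variables (V W : Type) (j : nat -> V) (k : W -> V).
Hypotheses (j_inj : injective j) (k_inj : injective k).
Variable R : (nat -> bool) -> (nat -> W) -> Prop.
Hypothesis R_closed : seq_closed R.

Let node (t : nat -> bool) (r : nat -> W) := mkseq (fun i => (t i, r i)).
Let through (a : seq (bool * W)) : set (nat -> bool) :=
  [set t | exists2 r, R t r & a = node t r (size a)].
Let large a := ~ embeds (through a) V.

Let node_embedding : exists p : seq (bool * W) -> V, injective p.
Proof.
have [p pI] := seq_embedding j_inj; have [q qI] := square_embedding j_inj.
exists (p \o map (fun x => q (j (nat_of_bool x.1), k x.2))).
apply: inj_comp => //; apply: inj_map => -[b w] [b' w'] /= /qI[/j_inj bb' /k_inj->].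
by move: bb'; case: b; case: b'.
Qed.

Let take_node t r m n : (m <= n)%N -> take m (node t r n) = node t r m.
Proof. by move=> mn; rewrite /node /mkseq -map_take take_iota (minn_idPl mn). Qed.

Let size_node t r n : size (node t r n) = n.
Proof. by rewrite size_mkseq. Qed.

Let clash (a b : seq (bool * W)) := exists i, [/\ (i < size a)%N, (i < size b)%N &
  nth false (unzip1 a) i <> nth false (unzip1 b) i].

Let nth_node t r n i : (i < n)%N -> nth false (unzip1 (node t r n)) i = t i.
Proof. by move=> ni; rewrite /unzip1 /node /mkseq -map_comp (nth_mkseq false t). Qed.

Let split_large a : large a -> exists e : bool -> seq (bool * W),
  [/\ forall b, large (e b), forall b, (size a < size (e b))%N,
      forall b, take (size a) (e b) = a & clash (e true) (e false)].
Proof.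
move=> la; pose B : set (nat -> bool) := fun t => exists r, [/\ R t r, a = node t r (size a) &
  forall n, large (node t r n)].
have [Bsmall|] := pselect (forall x y, B x -> B y -> x = y).
  exfalso; apply: la; have [p pI] := node_embedding.
  pose A (c : seq (bool * W)) := if pselect (large c) then B else through c.
  apply: (@embeds_sub _ _ _ (\bigcup_c A c)); last first.
    apply: (embeds_bigcup j_inj pI) => c; rewrite /A; case: pselect => [?|/contrapT//] /=.
    exact: embeds_subsingleton.
  move=> t [r Rtr ea].
  have [h|] := pselect (forall n, large (node t r n)).
    exists a => //; rewrite /A; case: pselect => [?|h'] /=; first by exists r.
    by case: h'; rewrite ea; exact: h.
  move=> /existsNP[n nl]; exists (node t r n) => //; rewrite /A; case: pselect => //= ?.
  by exists r => //; rewrite size_node.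
move=> /existsNP[x /existsNP[y /not_implyP[[r [Rx xa xl]] /not_implyP[[r' [Ry ya yl]]]]]].
move=> xy; have /existsNP[i xyi] : ~ forall i, x i = y i by move=> /funext.
pose n := maxn i.+1 (size a).+1.
exists (fun b => if b then node x r n else node y r' n); split.
- by case.
- by case; rewrite size_node leq_max ltnSn orbT.
- by case; rewrite take_node -?xa -?ya // leq_max leqnSn orbT.
- have ni : (i < n)%N by rewrite leq_max ltnSn.
  by exists i; rewrite !size_node !nth_node.
Qed.

(** Splitting large nodes repeatedly gives a Cantor scheme sch indexed by finite
    bit sequences.  The map q is defined on all t: it descends the scheme, at
    each step following the bit true exactly when t agrees with that node; on
    the limit points of the scheme this recovers the branch. *)
Lemma perfect_set (w0 : W) : ~ embeds [set t | exists r, R t r] V ->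
  exists q : (nat -> bool) -> (nat -> bool),
    (forall n, exists m, forall t t', agree m t t' -> agree n (q t) (q t')) /\
    (forall u, exists t r, R t r /\ q t = u).
Proof.
move=> root.
have l0 : large [::].
  move=> h; apply: root; apply: embeds_sub h => t [r Rtr].
  by exists r.
have /choice[e eP] : forall a, exists e : bool -> seq (bool * W), large a ->
  [/\ forall b, large (e b), forall b, (size a < size (e b))%N,
      forall b, take (size a) (e b) = a & clash (e true) (e false)].
  move=> a; have [/split_large[e eP]|n] := pselect (large a); first by exists e.
  by exists (fun=> a).
pose sch := foldl e [::].
have schS s b : sch (rcons s b) = e (sch s) b by rewrite /sch foldl_rcons.
have schl s : large (sch s).
  by elim/last_ind: s => // s b IH; rewrite schS; case: (eP _ IH).
have schsz s b : (size (sch s) < size (sch (rcons s b)))%N.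
  by rewrite schS; case: (eP _ (schl s)).
have schsize s : (size s <= size (sch s))%N.
  elim/last_ind: s => // s b IH; rewrite size_rcons; exact: leq_ltn_trans (schsz _ _).
have pre s b : take (size (sch s)) (sch (rcons s b)) = sch s.
  by rewrite schS; case: (eP _ (schl s)).
pose br (u : nat -> bool) n := sch (mkseq u n).
have brS u n : br u n.+1 = sch (rcons (mkseq u n) (u n)) by rewrite /br mkseqS.
have brt u n m : (n <= m)%N -> take (size (br u n)) (br u m) = br u n.
  move=> /subnK<-; elim: (m - n)%N => [|d IH]; first by rewrite take_size.
  have h : take (size (br u (d + n))) (br u (d + n).+1) = br u (d + n) by rewrite brS pre.
  rewrite -[in RHS]IH -[in RHS]h addSn take_takel //.
  rewrite -IH size_take; case: ltnP => //; exact: ltnW.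
have brsz u n : (n <= size (br u n))%N by rewrite -{1}(size_mkseq u n); exact: schsize.
pose lim u i := nth (true, w0) (br u i.+1) i.
have limE u n i : (i < size (br u n))%N -> nth (true, w0) (br u n) i = lim u i.
  move=> h; rewrite /lim; case: (leqP i.+1 n) => c.
    by rewrite -(brt u _ _ c) nth_take // brsz.
  by rewrite -(brt u n i.+1) ?nth_take // ltnW.
pose tl u i := (lim u i).1; pose rl u i := (lim u i).2.
have brE u n : br u n = node (tl u) (rl u) (size (br u n)).
  apply: (@eq_from_nth _ (true, w0)); rewrite ?size_node // => i h.
  by rewrite nth_mkseq // limE // /tl /rl; case: (lim u i).
have limR u : R (tl u) (rl u).
  apply: R_closed => n.
  have [t [r Rtr E]] : exists t, through (br u n) t.
    apply: contrapT => /forallNP h; apply: (schl (mkseq u n)).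
    by apply: embeds_subsingleton => // x y /h.
  have lE i : (i < n)%N -> lim u i = (t i, r i).
    move=> ni; have h := leq_trans ni (brsz u n).
    by rewrite -(limE u n i h) {1}E nth_mkseq.
  by exists t, r; split=> // i /lE; rewrite /tl /rl => ->.
pose meets (a : seq (bool * W)) (t : nat -> bool) := [forall i : 'I_(size a), nth false (unzip1 a) i == t i].
pose qs (t : nat -> bool) := fix qs n := if n is n'.+1 then
  let b := qs n' in rcons b (meets (sch (rcons b true)) t) else [::].
have qssz t n : size (qs t n) = n by elim: n => //= n IH; rewrite size_rcons IH.
pose q t n := meets (sch (rcons (qs t n) true)) t.
have qsE t n : qs t n = mkseq (q t) n.
  by elim: n => // n IH; rewrite mkseqS -IH.
exists q; split.
  suff H n : exists m, forall t t', agree m t t' -> qs t n = qs t' n.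
    move=> n; have [m hm] := H n; exists m => t t' /hm; rewrite !qsE => h i ni.
    by rewrite -(nth_mkseq false (q t) ni) h nth_mkseq.
  elim: n => [|n [m hm]]; first by exists 0%N.
  pose M := \max_(b : n.-tuple bool) size (sch (rcons b true)).
  exists (maxn m M) => t t' h /=.
  have Eq : qs t n = qs t' n by apply: hm; apply: agreeW h; rewrite leq_maxl.
  rewrite -Eq; congr rcons; apply: eq_forallb => i; congr (_ == _); apply: h.
  rewrite leq_max; apply/orP; right; apply: leq_trans (ltn_ord i) _.
  have sz : size (qs t n) == n by rewrite qssz.
  exact: (@leq_bigmax _ (fun b : n.-tuple bool => size (sch (rcons b true))) (Tuple sz)).
move=> u; exists (tl u), (rl u); split=> //.
have meetsE n : meets (br u n) (tl u).
  apply/forallP => -[i h] /=; apply/eqP.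
  by rewrite brE nth_node.
suff H n : qs (tl u) n = mkseq u n.
  apply/funext => n; have := H n.+1; rewrite qsE => h.
  by rewrite -(nth_mkseq false (q (tl u)) (ltnSn n)) h nth_mkseq.
elim: n => // n IH; rewrite mkseqS /= IH; congr rcons.
have := meetsE n.+1; rewrite brS; case: (u n) => // mf; apply/negP => mt.
have [_ _ _ [i [i1 i2]]] := eP _ (schl (mkseq u n)); rewrite -!schS in i1 i2 *.
case.
by have /eqP-> := forallP mt (Ordinal i1); have /eqP-> := forallP mf (Ordinal i2).
Qed.

End perfect_set.

(** * Coanalytic sets and the first uncountable ordinal *)

Lemma well_order_total (T : eqType) (R : rel T) : well_order R ->
  [/\ total R, antisymmetric R & transitive R].
Proof.
move=> wo.
have wc : wo_chain R predT by exact: withinW.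
have tot : total R by exact: in2T (wo_chainW wc).
have anti : antisymmetric R by exact: in2T (wo_chain_antisymmetric wc).
split=> // y x z xy yz.
have [|m [[]]] := wo (pred3 x y z); first by exists x; rewrite inE eqxx.
rewrite inE => /or3P[]/eqP-> h _.
- by apply: h; rewrite !inE eqxx !orbT.
- have yx : R y x by apply: h; rewrite !inE eqxx.
  by rewrite (anti x y) // xy.
- have zy : R z y by apply: h; rewrite !inE eqxx orbT.
  by rewrite (anti z y) ?yz // zy.
Qed.

(** Inside a well-ordering of V, the elements with countably many predecessors
    form a copy W of the first uncountable ordinal.  Countable subsets of W are
    bounded, which is what ranks of countably branching trees require. *)
Lemma omega1_exists (V : Type) : ~ countable [set: V] ->
  exists (W : Type) (k : W -> V) (lt : W -> W -> Prop), [/\ injective k, inhabited W,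
    forall A : set W, A !=set0 -> exists2 m, A m & forall x, A x -> ~ lt x m,
    forall x y z, ~ lt y x -> lt y z -> lt x z &
    forall f : nat -> W, exists w, forall n, lt (f n) w].
Proof.
elim/Peq: V => V unc; have [R wo] := well_ordering_principle V.
have [tot anti trans] := well_order_total wo.
pose lt x y := ~~ R y x.
have minP (A : set V) : A !=set0 -> exists2 m, A m & forall x, A x -> ~ lt x m.
  move=> [x Ax]; have [|m [[]]] := wo [pred x | `[< A x >]].
    by exists x; apply/asboolP.
  move=> /asboolP Am h _; exists m => // y Ay; rewrite /lt => /negP; apply.
  by apply: h; exact/asboolP.
have lelt x y z : ~ lt y x -> lt y z -> lt x z.
  rewrite /lt => /negP; rewrite negbK => xy; apply: contra => zx; exact: trans zx xy.
pose P : set V := fun x => countable [set y | lt y x].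
have countableP_min m : (forall x, lt x m -> P x) -> countable P -> P m.
  move=> h; apply: sub_countable; apply: subset_card_le => y; exact: h.
exists {x | P x}, sval, (fun x y => lt (sval x) (sval y)); split.
- by move=> [x Px] [y Py] /= xy; exact: eq_exist.
- have [|m _ hm] := minP setT; last first.
    constructor; exists m; apply: (@sub_countable _ _ _ (@set0 V)); last exact: countable0.
    by apply: subset_card_le => y /hm; apply.
  by apply/set0P/eqP => e; apply: unc; rewrite e; exact: countable0.
- move=> A [x0 Ax0]; have [|m [y Ay <-] h] := minP (sval @` A).
    by exists (sval x0), x0.
  by exists y => // z Az; apply: h; exists z.
- by move=> [x Px] [y Py] [z Pz]; exact: lelt.
- move=> f; apply: contrapT => /forallNP h; apply: unc.
  have cP : countable P.
    pose C (i : nat * bool) := if i.2 then [set sval (f i.1)] else [set y | lt y (sval (f i.1))].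
    apply: (@sub_countable _ _ _ (\bigcup_i C i)); last first.
      apply: bigcup_countable; first exact: countableP.
      by move=> [n []] _; [exact: countable1|exact: svalP (f n)].
    apply: subset_card_le => x Px; have /existsNP[n nl] := h (exist _ x Px).
    have [->|ne] := eqVneq x (sval (f n)); first by exists (n, true).
    exists (n, false) => //; rewrite /C /= /lt; apply/negP => xf; move/eqP: ne; apply.
    by apply: anti; rewrite xf andbT; move/negP: nl; rewrite /lt /= negbK.
  have [<-//|/existsNP[x nx]] : P = setT \/ ~ forall x, P x.
    by have [p|] := pselect (forall x, P x); [left; apply/seteqP; split=> x _ //; exact: p|right].
  have [|m nm hm] := minP (~` P); first by exists x.
  by case: nm; apply: countableP_min => // y ym; apply: contrapT => /hm.
Qed.

Lemma uncountable_nat_embedding (V : Type) : ~ countable [set: V] ->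
  exists j : nat -> V, injective j.
Proof.
move=> unc; have /infiniteP/card_leP[f] : infinite_set [set: V] by move=> /finite_set_countable.
exists (fun n => sval (f (SigSub (mem_set (I : [set: nat] n))))).
by move=> m n /val_inj /(inj (mem_set I) (mem_set I))[].
Qed.

Section coanalytic.
Variables (V : Type).
Hypothesis unc : ~ countable [set: V].
Variable S : (nat -> bool) -> (nat -> nat) -> Prop.
Hypothesis S_closed : seq_closed S.

(* Nodes of the tree of attempts to find b with S t b. *)
Let tree t s := exists t' b, [/\ agree (size s) t t', s = mkseq b (size s) & S t' b].

Section rank.
Variables (W : Type) (lt : W -> W -> Prop).
Hypothesis lt_min : forall A : set W, A !=set0 -> exists2 m, A m & forall x, A x -> ~ lt x m.
Hypothesis le_lt_trans : forall x y z, ~ lt y x -> lt y z -> lt x z.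
Hypothesis lt_bound : forall f : nat -> W, exists w, forall n, lt (f n) w.
Variable w0 : W.

Let ranks t (r : nat -> W) := forall s n, tree t (rcons s n) ->
  lt (r (pickle (rcons s n))) (r (pickle s)).

Let tree_agree t t' s : agree (size s) t t' -> tree t s -> tree t' s.
Proof.
move=> tt' [u [b [tu sb Su]]]; exists u, b; split=> // i si.
by rewrite -tu // tt'.
Qed.

Let ranks_closed : seq_closed ranks.
Proof.
move=> t r h s n ts.
pose m := maxn (size s).+1 (maxn (pickle (rcons s n)).+1 (pickle s).+1).
have [t' [r' [tt' rr' rk]]] := h m.
rewrite !rr' ?leq_max ?ltnSn ?orbT //; apply: rk; apply: tree_agree ts.
by rewrite size_rcons; apply: agreeW tt'; rewrite leq_max leqnn.
Qed.

Inductive rank_le (t : nat -> bool) (s : seq nat) (w : W) : Prop :=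
  RankLe of (forall n, tree t (rcons s n) -> exists2 w', lt w' w & rank_le t (rcons s n) w').

Let no_branch t b : ~ S t b -> ~ forall n, tree t (mkseq b n).
Proof.
move=> nS h; apply: nS; apply: S_closed => n.
have [t' [b' [tt' bb' Sb]]] := h n; rewrite size_mkseq in tt' bb'.
exists t', b'; split=> // i ni.
by rewrite -(nth_mkseq 0%N b ni) bb' nth_mkseq.
Qed.

Let ranksP t : (forall b, ~ S t b) <-> exists r, ranks t r.
Proof.
split=> [nS|[r rk] b Sb]; last first.
  have tb n : tree t (mkseq b n) by exists t, b; rewrite size_mkseq.
  have [|m [n _ <-] h] := @lt_min (range (fun n => r (pickle (mkseq b n)))).
    by exists (r (pickle (mkseq b 0))), 0%N.
  apply: (h (r (pickle (mkseq b n.+1)))); first by exists n.+1.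
  by rewrite mkseqS; apply: rk; rewrite -mkseqS.
have step s : (forall w, ~ rank_le t s w) ->
    exists n, tree t (rcons s n) /\ forall w, ~ rank_le t (rcons s n) w.
  move=> h; apply: contrapT => /forallNP h'.
  have /choice[f fP] : forall n, exists w, tree t (rcons s n) -> rank_le t (rcons s n) w.
    move=> n; have [tn|ntn] := pselect (tree t (rcons s n)); last by exists w0.
    have /not_andP[//|] := h' n.
    by move=> /existsNP[w /contrapT rw]; exists w.
  have [w hw] := lt_bound f; apply: (h w); split=> n tn; exists (f n) => //; exact: fP.
have ranked s : tree t s -> exists w, rank_le t s w.
  move=> ts; apply: contrapT => /forallNP ns.
  have /choice[g gP] : forall s, exists n, (forall w, ~ rank_le t s w) ->
      tree t (rcons s n) /\ forall w, ~ rank_le t (rcons s n) w.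
    move=> s'; have [/step[n hn]|h] := pselect (forall w, ~ rank_le t s' w); first by exists n.
    by exists 0%N.
  pose br n := iter n (fun s => rcons s (g s)) s.
  have brP n : tree t (br n) /\ forall w, ~ rank_le t (br n) w.
    by elim: n => //= n [_ IH]; exact: gP.
  pose b n := nth 0%N (br n.+1) n.
  have brsz n : size (br n) = (size s + n)%N.
    by elim: n => [|n IH]; rewrite ?addn0 //= size_rcons IH addnS.
  have brt m n : (m <= n)%N -> take (size (br m)) (br n) = br m.
    move=> /subnK<-; elim: (n - m)%N => [|d IH]; first by rewrite take_size.
    rewrite addSn /= -cats1 takel_cat // !brsz leq_add2l.
    by rewrite leq_addl.
  have brE n : br n = mkseq b (size (br n)).
    apply: (@eq_from_nth _ 0%N); rewrite ?size_mkseq // => i h.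
    rewrite nth_mkseq // /b; have [c|c] := leqP i.+1 n.
      by rewrite -(brt _ _ c) nth_take // brsz ltn_addl.
    by rewrite -(brt n i.+1) ?nth_take // ltnW.
  apply: (@no_branch t b) => // n; have [[u [b' [tu sb Su]]] _] := brP n.
  exists u, b'; rewrite size_mkseq; split=> //.
    by apply: agreeW tu; rewrite brsz leq_addl.
  have h : (n <= size (br n))%N by rewrite brsz leq_addl.
  apply: (@eq_from_nth _ 0%N); rewrite ?size_mkseq // => i ni.
  rewrite !nth_mkseq //; have h' := leq_trans ni h.
  by rewrite -(nth_mkseq 0%N b h') -brE sb nth_mkseq // -sb.
have /choice[r rP] : forall s, exists w, tree t s ->
    rank_le t s w /\ forall x, rank_le t s x -> ~ lt x w.
  move=> s; have [/ranked[w hw]|n] := pselect (tree t s); last by exists w0.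
  by have [|m hm mm] := @lt_min (rank_le t s); [exists w|exists m].
exists (fun n => r (odflt [::] (unpickle n))) => s n tn; rewrite !pickleK /=.
have ts : tree t s.
  have [u [b [tu sb Su]]] := tn; exists u, b; split=> //.
    by apply: agreeW tu; rewrite size_rcons.
  have := congr1 (take (size s)) sb.
  by rewrite -cats1 take_size_cat // size_cat addn1 mkseqS -cats1 take_size_cat ?size_mkseq.
have [[/(_ n tn)[w' w'r rw']] _] := rP _ ts.
by apply: le_lt_trans w'r; case: (rP _ tn) => _; apply.
Qed.

(** A tree without infinite branch has a rank function with values in W, and a
    tree with a rank function has no infinite branch.  Rank functions, listed as
    sequences over W, satisfy a closed condition. *)
Lemma coanalytic_suslin : exists2 Rk, seq_closed Rk &
  forall t, (forall b, ~ S t b) <-> exists r : nat -> W, Rk t r.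
Proof. by exists ranks. Qed.

End rank.

(** For V of cardinality aleph_1 this is the classical fact that a coanalytic
    set with more than aleph_1 points has a perfect subset.  The perfect subset
    is delivered through a continuous map q defined everywhere. *)
Theorem coanalytic_perfect_set : ~ embeds [set t | forall b, ~ S t b] V ->
  exists q : (nat -> bool) -> (nat -> bool),
    (forall n, exists m, forall t t', agree m t t' -> agree n (q t) (q t')) /\
    (forall u, exists2 t, (forall b, ~ S t b) & q t = u).
Proof.
have [j ji] := uncountable_nat_embedding unc.
have [W [k [lt [ki [w0] lt_min le_lt lt_bound]]]] := omega1_exists unc.
move=> nemb.
have [Rk Rk_closed RkP] := coanalytic_suslin lt_min le_lt lt_bound w0.
have [|q [qc qs]] := perfect_set ji ki Rk_closed w0.
  move=> e; apply: nemb; apply: embeds_sub e => t /RkP[r rr].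
  by exists r.
exists q; split=> // u; have [t [r [rr <-]]] := qs u; exists t => //.
by apply/RkP; exists r.
Qed.

End coanalytic.

Import Order.TTheory GRing.Theory Num.Theory.
Import numFieldNormedType.Exports.
Local Open Scope ring_scope.

(** * Cardinality of the reals and of the Borel sets; analytic sets *)

Section real_cardinality.
Variable R : realType.

Lemma real_to_cantor : exists f : R -> (nat -> bool), injective f.
Proof.
exists (fun x n => if unpickle n is Some q then ratr q < x else false).
have aux (x y : R) : x < y -> exists q : rat, (ratr q < x) != (ratr q < y).
  move=> /rat_in_itvoo[q]; rewrite in_itv /= => /andP[xq qy].
  by exists q; rewrite qy ltNge (ltW xq).
move=> x y e; apply/eqP; case: ltgtP => // /aux[q].
  by have := congr1 (@^~ (pickle q)) e; rewrite /= pickleK => ->; rewrite eqxx.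
by have := congr1 (@^~ (pickle q)) e; rewrite /= pickleK => ->; rewrite eqxx.
Qed.

(** Ternary expansions with digits 0 and 1: the digit at the first difference
    outweighs all the later ones. *)
Lemma cantor_to_real : exists f : (nat -> bool) -> R, injective f.
Proof.
pose p n : R := 3^-1 ^+ n.
have p0 n : 0 < p n by rewrite exprn_gt0 // invr_gt0.
have pS n : p n = 3 * p n.+1 by rewrite /p exprS mulrA divff ?mul1r.
pose S (x : nat -> bool) n := \sum_(i < n) (x i)%:R * p i.
have SS x n : S x n.+1 = S x n + (x n)%:R * p n by rewrite /S big_ord_recr.
have tail x m n : (m <= n)%N -> S x m <= S x n <= S x m + 3 / 2 * (p m - p n).
  move=> /subnK<-; elim: (n - m)%N => [|d /andP[IH1 IH2]].
    by rewrite subrr mulr0 addr0 lexx.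
  rewrite addSn SS; have := p0 (d + m)%N; have := p0 (d + m).+1; have := pS (d + m)%N.
  move: (x (d + m)%N) => [] /= h1 h2 h3; apply/andP; split; lra.
pose f x := sup (range (S x)).
have ub x m : ubound (range (S x)) (S x m + 3 / 2 * p m).
  move=> _ [n _ <-]; have := p0 m; have := p0 n; have [mn|nm] := leqP m n.
    by have /andP[] := tail x m n mn; move: (S x m) (S x n); intros; lra.
  by have /andP[] := tail x n m (ltnW nm); move: (S x m) (S x n); intros; lra.
have le_f x m : S x m <= f x.
  by apply: ub_le_sup; [exists (S x 0%N + 3 / 2 * p 0%N); exact: ub|exists m].
have f_le x m : f x <= S x m + 3 / 2 * p m.
  by apply: ge_sup; [exists (S x 0%N), 0%N|exact: ub].
have aux x y m : agree m x y -> x m = false -> y m = true -> f x < f y.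
  move=> xy xm ym; have := f_le x m.+1; have := le_f y m.+1.
  rewrite !SS xm ym (_ : S y m = S x m).
    have := pS m; have := p0 m.+1; move: (S x m) (f x) (f y) => /=; intros; lra.
  by apply: eq_bigr => i _; rewrite xy.
exists f => x y e; apply: contrapT => xy.
have /existsNP[n xyn] : ~ forall n, x n = y n by move=> /funext.
have [|m xym mm] := @ex_minnP (fun n => x n != y n); first by exists n; apply/eqP.
have ag : agree m x y.
  move=> i im; apply/eqP; apply: contraTT im => /mm; by rewrite -leqNgt.
case xm : (x m); case ym : (y m); move: xym; rewrite xm ym // => _.
  by have := aux y x m (agree_sym ag) ym xm; rewrite e ltxx.
by have := aux x y m ag xm ym; rewrite e ltxx.
Qed.

End real_cardinality.

Section borel_sets.
Variables (R : realType) (X : topologicalType).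
Hypothesis polish_X : polish R X.

Lemma polish_base : exists U : nat -> set X,
  forall A, open A -> A = \bigcup_(n in [set n | U n `<=` A]) U n.
Proof.
have [[D /countable_injP[f fI] dD] [d [[d0 dC dT] dind _]]] := polish_X.
pose U n : set X := [set y | exists x m, [/\ D x, unpickle n = Some (f x, m) & d x y < m.+1%:R^-1]].
exists U => A oA; apply/seteqP; split=> [y Ay|y [n UA /UA//]].
have [e e0 eA] : exists2 e, 0 < e & [set z | d y z < e] `<=` A.
  by apply/dind; exact: open_nbhs_nbhs.
have [m me] : exists m : nat, m.+1%:R^-1 < e / 2.
  exists (Num.truncn (e / 2)^-1); rewrite invf_plt ?posrE ?divr_gt0 //.
  by rewrite truncnS_gt.
pose B := [set z | d y z < m.+1%:R^-1].
have yB : nbhs y B by apply/dind; exists m.+1%:R^-1; rewrite ?invr_gt0.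
have [x [/interior_subset Bx Dx]] : B^° `&` D !=set0.
  by apply: dD; [exists y; rewrite /interior /=|exact: open_interior].
have xD : x \in D by exact: mem_set.
exists (pickle (f x, m)).
  move=> z [x' [m' [Dx']]]; rewrite pickleK => -[ff <- dz].
  have ex : x' = x by apply: fI; rewrite ?inE.
  rewrite ex in dz; apply: eA => /=; apply: le_lt_trans (dT _ x _) _.
  by rewrite (splitr e) ltrD ?(lt_trans _ me).
by exists x, m; rewrite pickleK dC.
Qed.

Inductive borel_code := Base of nat | Compl of borel_code | Union of (nat -> borel_code).

Let enc := fix enc (c : borel_code) : seq nat -> nat := fun s =>
  match c, s with
  | Base n, [::] => n.+2
  | Base n, _ :: _ => 0%N
  | Compl c, [::] => 0%N
  | Compl c, _ :: s => enc c s
  | Union f, [::] => 1%N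
  | Union f, k :: s => enc (f k) s
  end.

Let enc_inj : injective enc.
Proof.
elim=> [n|c IH|f IH] [m|d|g] e; have e0 := congr1 (fun h : seq nat -> nat => h [::]) e => //.
- by case: e0 => ->.
- by congr Compl; apply: IH; apply/funext => s; exact: (congr1 (fun h : seq nat -> nat => h (0%N :: s)) e).
- congr Union; apply/funext => k; apply: IH; apply/funext => s.
  exact: (congr1 (fun h : seq nat -> nat => h (k :: s)) e).
Qed.

(** Borel sets have well-founded codes, and such a code is determined by the
    labels of its nodes. *)
Lemma borel_embeds : embeds (@borel X) R.
Proof.
have [U Ubase] := polish_base.
pose den := fix den c := match c with
  | Base n => U n | Compl c => ~` den c | Union f => \bigcup_n den (f n) end.
pose none := Compl (Union (fun n => if n is 0%N then Compl (Base 0) else Base 0)).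
have den0 : den none = set0.
  rewrite -subset0 => x; apply; have [u|nu] := pselect (U 0%N x); first by exists 1%N.
  by exists 0%N.
have /choice[code codeP] : forall B, exists c, borel B -> den c = B.
  move=> B; have [|nB] := pselect (borel B); last by exists none.
  move: B; suff h : @borel X `<=` range den by move=> B /h[c _ <-]; exists c.
  apply: smallest_sub => [|A oA].
    split; first by exists none.
      by move=> _ [c _ <-]; rewrite setTD; exists (Compl c).
    move=> A hA; have /choice[f fA] : forall n, exists c, den c = A n.
      by move=> n; have [c _ <-] := hA n; exists c.
    by exists (Union f) => //=; apply: eq_bigcupr => n _; exact: fA.
  exists (Union (fun n => if pselect (U n `<=` A) then Base n else none)) => //=.
  rewrite [RHS]Ubase //; apply/seteqP; split=> [x [n _]|x [n nA Ux]].
    have n0 : ~ den none x by rewrite den0.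
    by case: pselect => [nA /= Ux|_ /n0]; first by exists n.
  by exists n => //; case: pselect.
have [g gI] := cantor_to_real R.
pose graph (h : seq nat -> nat) n := if unpickle n is Some (s, m) then h s == m else false.
have graph_inj : injective graph.
  move=> h h' e; apply/funext => s; have := congr1 (@^~ (pickle (s, h s))) e.
  by rewrite /graph pickleK eqxx => /esym/eqP.
exists (fun B => g (graph (enc (code B)))) => B C /codeP hB /codeP hC.
by move=> /gI/graph_inj/enc_inj; rewrite -{2}hB -{2}hC => ->.
Qed.

End borel_sets.

Section analytic.
Variables (R : realType) (X : topologicalType).

(** Projections of closed subsets of the product with the Baire space, whose
    topology is again expressed with finite prefixes. *)
Definition analytic (A : set X) := exists E : X -> (nat -> nat) -> Prop,
  (forall x b, (forall n U, nbhs x U -> exists x' b', [/\ U x', agree n b b' & E x' b']) -> E x b) /\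
  (forall x, A x <-> exists b, E x b).

Lemma closed_analytic C : closed C -> analytic C.
Proof.
move=> cC; exists (fun x _ => C x); split=> [x b h|x].
  apply: cC => U /(h 0%N)[x' [_ [Ux _ Cx]]].
  by exists x'.
by split=> [Cx|[]//]; exists id.
Qed.

Lemma bigcup_analytic (A : nat -> set X) : (forall n, analytic (A n)) -> analytic (\bigcup_n A n).
Proof.
move=> /choice[E EP]; exists (fun x b => E (b 0%N) x (b \o S)); split=> [x b h|x].
  have [Ec _] := EP (b 0%N); apply: Ec => n U xU.
  have [x' [b' [Ux bb Eb]]] := h n.+1 U xU; exists x', (b' \o S); split=> //.
    by move=> i ni; exact: bb.
  by rewrite (bb 0%N).
split=> [[n _ Ax]|[b Eb]].
  have [_ /(_ x)[/(_ Ax)[b Eb] _]] := EP n; exists (fun i => if i is i'.+1 then b i' else n) => //.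
by exists (b 0%N) => //; have [_ ->] := EP (b 0%N); exists (b \o S).
Qed.

Lemma bigcap_analytic (A : nat -> set X) : (forall n, analytic (A n)) -> analytic (\bigcap_n A n).
Proof.
move=> /choice[E EP]; exists (fun x b => forall k, E k x (fun i => b (pickle (k, i)))).
split=> [x b h k|x].
  have [Ec _] := EP k; apply: Ec => n U xU.
  pose m := (\max_(i < n) (pickle (k, val i)).+1)%N.
  have [x' [b' [Ux bb Eb]]] := h m U xU.
  exists x', (fun i => b' (pickle (k, i))); split=> // i ni; apply: bb.
  exact: (@leq_bigmax _ (fun i : 'I_n => (pickle (k, val i)).+1) (Ordinal ni)).
split=> [Ax|[b Eb] k _]; last by have [_ ->] := EP k; eexists; exact: Eb.
have /choice[b bE] : forall k, exists b, E k x b by move=> k; have [_ <-] := EP k; exact: Ax.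
exists (fun n => if unpickle n is Some (k, i) then b k i else 0%N) => k.
suff -> : (fun i => if unpickle (pickle (k, i)) is Some (k, i) then b k i else 0%N) = b k by exact: bE.
by apply/funext => i; rewrite pickleK.
Qed.

Hypothesis polish_X : polish R X.

Lemma open_analytic A : open A -> analytic A.
Proof.
have [_ [d [[d0 dC dT] dind _]]] := polish_X => oA.
pose C n := [set x | forall y, d x y < n.+1%:R^-1 -> A y].
have -> : A = \bigcup_n C n.
  apply/seteqP; split=> [x Ax|x [n _]]; last first.
    by apply; rewrite (_ : d x x = 0) ?invr_gt0 //; exact/d0.
  have [e e0 eA] : exists2 e, 0 < e & [set z | d x z < e] `<=` A.
    by apply/dind; exact: open_nbhs_nbhs.
  exists (Num.truncn e^-1) => // y dy; apply: eA; apply: lt_trans dy _.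
  by rewrite invf_plt ?posrE // truncnS_gt.
apply: bigcup_analytic => n; apply: closed_analytic => x xC y dxy.
have xU : nbhs x [set z | d x z < n.+1%:R^-1 - d x y].
  by apply/dind; exists (n.+1%:R^-1 - d x y); rewrite ?subr_gt0.
have [x' [Cx dx]] := xC _ xU.
apply: Cx; apply: le_lt_trans (dT _ x _) _; rewrite dC.
by move: dx => /=; rewrite ltrBrDr.
Qed.

(** The sets that are analytic together with their complement form a
    sigma-algebra. *)
Lemma borel_analytic B : borel B -> analytic B /\ analytic (~` B).
Proof.
move: B; suff h : @borel X `<=` [set B | analytic B /\ analytic (~` B)] by move=> B /h.
apply: smallest_sub => [|A oA]; last first.
  by split; [exact: open_analytic|apply: closed_analytic; exact: open_closedC].
split=> [|A [hA hC]|A hA] /=.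
- by rewrite setC0; split; apply: closed_analytic; [exact: closed0|exact: closedT].
- by rewrite setTD setCK.
- split; first by apply: bigcup_analytic => n; case: (hA n).
  by rewrite setC_bigcup; apply: bigcap_analytic => n; case: (hA n).
Qed.

End analytic.

(** * Identities in abelian groups *)

(** The tactic zmod decides equations between sums in an abelian group by
    comparing the integer coefficients of the atoms. *)
Inductive zexpr := ZVar of nat | ZZero | ZAdd of zexpr & zexpr | ZOpp of zexpr.

Section zexpr.
Variable X : zmodType.

Fixpoint zeval (env : seq X) e := match e with
  | ZVar n => env`_n | ZZero => 0
  | ZAdd e1 e2 => zeval env e1 + zeval env e2 | ZOpp e => - zeval env e end.

Fixpoint zcoef (i : nat) e : int := match e with
  | ZVar n => (n == i)%:Z | ZZero => 0
  | ZAdd e1 e2 => zcoef i e1 + zcoef i e2 | ZOpp e => - zcoef i e end.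

Lemma zevalE env e : zeval env e = \sum_(i < size env) env`_i *~ zcoef i e.
Proof.
elim: e => /= [n||e1 -> e2 ->|e ->].
- have [ns|ns] := ltnP n (size env).
    rewrite (bigD1 (Ordinal ns)) //= eqxx mulr1z big1 ?addr0 // => i /negbTE ni.
    by rewrite eq_sym -val_eqE /= in ni; rewrite ni mulr0z.
  rewrite nth_default // big1 // => i _.
  by rewrite (_ : (n == i) = false) ?mulr0z // gtn_eqF // (leq_trans (ltn_ord i)).
- by rewrite big1 // => i _; rewrite mulr0z.
- by rewrite -big_split; apply: eq_bigr => i _; rewrite mulrzDr.
- by rewrite -sumrN; apply: eq_bigr => i _; rewrite mulrNz.
Qed.

Lemma zevalP env e1 e2 :
  all (fun i => zcoef i e1 == zcoef i e2) (iota 0 (size env)) -> zeval env e1 = zeval env e2.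
Proof.
move=> /allP h; rewrite !zevalE; apply: eq_bigr => i _.
by rewrite (eqP (h i _)) // mem_iota add0n /=.
Qed.
End zexpr.

Ltac zindex x l := lazymatch l with
  | x :: _ => constr:(0%N)
  | _ :: ?l => let n := zindex x l in constr:(n.+1) end.

Ltac zatoms l t := lazymatch t with
  | ?a + ?b => let l := zatoms l a in zatoms l b
  | - ?a => zatoms l a
  | 0 => l
  | _ => match l with
    | _ => let _ := zindex t l in l
    | _ => constr:(t :: l) end end.

Ltac zquote l t := lazymatch t with
  | ?a + ?b => let a := zquote l a in let b := zquote l b in constr:(ZAdd a b)
  | - ?a => let a := zquote l a in constr:(ZOpp a)
  | 0 => constr:(ZZero)
  | _ => let n := zindex t l in constr:(ZVar n) end.

Ltac zmod := match goal with |- @eq ?T ?x ?y =>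
  let l := zatoms (@nil T) x in let l := zatoms l y in
  let x' := zquote l x in let y' := zquote l y in
  exact: (@zevalP _ l x' y' isT) end.

(** * Polish abelian groups *)

Lemma half_pow_lt (R : realType) (e : R) : 0 < e -> exists N, 2^-1 ^+ N < e.
Proof.
have : (fun n => 2^-1 ^+ n : R) @ \oo --> (0 : R).
  by apply: cvg_expr; rewrite ger0_norm ?invr_ge0 // invf_lt1 // ltr1n.
move=> /cvgrPdist_lt h e0; have [N _ hN] := h e e0.
by exists N; have := hN N (leqnn N); rewrite /= sub0r normrN ger0_norm // ltW // exprn_gt0.
Qed.

Section topological_group.
Variable X : topologicalZmodType.
Implicit Types (x y z : X) (A U V W : set X).

Lemma nbhs_add x y U : nbhs (x + y) U ->
  exists V W, [/\ nbhs x V, nbhs y W & forall v w, V v -> W w -> U (v + w)].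
Proof.
move=> xyU; have [[V W] /= [xV yW] VW] := @add_continuous X (x, y) U xyU.
by exists V, W; split=> // v w Vv Ww; exact: (VW (v, w)).
Qed.

Lemma nbhs_translate x U : nbhs x U -> nbhs 0 [set v | U (x + v)].
Proof.
rewrite -{1}(addr0 x) => /nbhs_add[V [W [xV W0 VW]]].
by apply: filterS W0 => w; apply: VW; exact: nbhs_singleton.
Qed.

Lemma translate_nbhs x U : nbhs 0 U -> nbhs x [set y | U (y - x)].
Proof.
rewrite -{1}(subrr x) => /nbhs_add[V [W [xV Wx VW]]].
by apply: filterS xV => v Vv; apply: VW => //; exact: nbhs_singleton.
Qed.

Lemma nbhs_opp x U : nbhs x U -> nbhs (- x) [set y | U (- y)].
Proof. by rewrite -{1}(opprK x) => xU; exact: (@opp_continuous X (- x) U xU). Qed.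

(** The closure of a symmetric neighbourhood B lies in B + B, so halving twice
    leaves room for closedness. *)
Lemma nbhs0_half U : nbhs 0 U -> exists V, [/\ closed V, nbhs 0 V,
  forall x, V x -> V (- x) & forall x y, V x -> V y -> U (x + y)].
Proof.
have half A : nbhs 0 A -> exists V, [/\ nbhs 0 V, forall x, V x -> V (- x) &
    forall x y, V x -> V y -> A (x + y)].
  rewrite -{1}(addr0 (0 : X)) => /nbhs_add[V [W [V0 W0 VW]]].
  exists (V `&` W `&` [set x | (V `&` W) (- x)]); split.
  - by apply: filterI; [exact: filterI|rewrite -oppr0; apply: nbhs_opp; exact: filterI].
  - by move=> x [xVW nxVW]; split=> //=; rewrite opprK.
  - by move=> x y [[Vx _] _] [[_ Wy] _]; exact: VW.
move=> /half[A [A0 _ AU]]; have [B [B0 Bs BA]] := half A A0.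
have cBA x : closure B x -> A x.
  move=> /(_ _ (translate_nbhs x B0))[y [By /= Byx]].
  have -> : x = y + - (y - x) by zmod.
  by apply: BA => //; exact: Bs.
exists (closure B); split.
- exact: closed_closure.
- by apply: filterS B0; exact: subset_closure.
- move=> x Bx W /nbhs_opp; rewrite opprK => /Bx[y [By Wy]].
  by exists (- y); split=> //; exact: Bs.
- by move=> x y /cBA Ax /cBA Ay; exact: AU.
Qed.

Definition cauchy_seq (P : nat -> X) := forall U, nbhs 0 U ->
  exists N, forall m n, (N <= m)%N -> (N <= n)%N -> U (P m - P n).
Definition converges (P : nat -> X) z := forall U, nbhs 0 U ->
  exists N, forall m, (N <= m)%N -> U (P m - z).

Section complete.
Variable R : realType.
Hypothesis polish_X : polish R X.

Lemma metric_geometric (d : X -> X -> R) (u : nat -> X) :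
  is_metric d -> complete_metric d ->
  (forall n, d (u n) (u n.+1) < 2^-1 ^+ n) -> exists l : X, u @ \oo --> l.
Proof.
move=> [d0 dC dT] dc du; apply: dc => e e0.
have p0 n : 0 < 2^-1 ^+ n :> R by rewrite exprn_gt0.
have dE n k : d (u n) (u (k + n)%N) <= 2 * (2^-1 ^+ n - 2^-1 ^+ (k + n)).
  elim: k => [|k IH].
    by rewrite subrr mulr0 (_ : d _ _ = 0) //; exact/d0.
  apply: le_trans (dT _ (u (k + n)%N) _) _; have := du (k + n)%N.
  rewrite addSn exprS; move: IH; have := p0 (k + n)%N.
  move: (d _ _) (d _ _) (_ ^+ _) (_ ^+ _) => a b c f; lra.
have [N Ne] := half_pow_lt (divr_gt0 e0 (ltr0n R 4)).
exists N => m n Nm Nn.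
have dN k : (N <= k)%N -> d (u N) (u k) <= 2 * 2^-1 ^+ N.
  move=> /subnK<-; apply: le_trans (dE _ _) _; have := p0 (k - N + N)%N.
  by move: (_ ^+ _) (_ ^+ _) => a b; lra.
have := dN m Nm; have := dN n Nn; have := dT (u m) (u N) (u n); rewrite (dC (u m) (u N)).
by move: Ne; move: (d _ _) (d _ _) (d _ _) (_ ^+ _) => a b c f; lra.
Qed.

(** Klee: a Cauchy sequence P for the group uniformity converges although the
    complete metric d need not be invariant.  Two summands are moved in turn,
    u + w = P k, each step being so late in the sequence that the move is
    d-small at the point being moved; both summands are then d-Cauchy. *)
Lemma cauchy_converges P : cauchy_seq P -> exists z, converges P z.
Proof.
move=> cP; have [_ [d [dm dind dc]]] := polish_X; have [d0 dC dT] := dm.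
pose near (j : nat) (u : X) k := forall m, (k <= m)%N -> d u (u + (P m - P k)) < 2^-1 ^+ j.
have /choice[late lateP] : forall a : nat * X * nat, exists k, (a.2 < k)%N /\ near a.1.1 a.1.2 k.
  move=> [[j u] k0].
  have p0 : nbhs u [set v | d u v < 2^-1 ^+ j].
    by apply/dind; exists (2^-1 ^+ j) => //; rewrite exprn_gt0.
  have [N hN] := cP _ (nbhs_translate p0); exists (maxn N k0.+1); split=> /=.
    by rewrite leq_max ltnSn orbT.
  by move=> m; rewrite geq_max => /andP[Nm _]; apply: hN; rewrite // leq_max leqnn.
pose st := fix st j := if j is i.+1 then let: (u, w, k) := st i in
  let k' := late (i.+1, w, k) in (w, u + (P k' - P k), k')
  else let k := late (0%N, 0, 0%N) in (0, P k, k).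
pose u j := (st j).1.1; pose w j := (st j).1.2; pose k j := (st j).2.
have stS j : [/\ u j.+1 = w j, w j.+1 = u j + (P (k j.+1) - P (k j)) &
    k j.+1 = late (j.+1, w j, k j)].
  by rewrite /u /w /k /=; case: (st j) => -[].
have kS j : (k j < k j.+1)%N by have [_ _ ->] := stS j; case: (lateP (j.+1, w j, k j)).
have kj j : (j <= k j)%N by elim: j => // j IH; exact: leq_ltn_trans IH (kS j).
have near_u j : near j (u j) (k j).
  case: j => [|j]; first by case: (lateP (0%N, 0, 0%N)).
  by have [-> _ ->] := stS j; case: (lateP (j.+1, w j, k j)).
have uw j : u j + w j = P (k j).
  elim: j => [|j IH]; first by rewrite /u /w /k /= add0r.
  have [-> -> _] := stS j; rewrite addrCA addrA IH; zmod.
have du j : d (u j) (u j.+2) < 2^-1 ^+ j.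
  have [-> _ _] := stS j.+1; have [_ -> _] := stS j; apply: near_u.
  exact: ltnW.
have lim (i : nat) : exists l : X, (fun j => u (i + j.*2)%N) @ \oo --> l.
  apply: metric_geometric dm dc _ => j.
  rewrite doubleS !addnS; apply: lt_le_trans (du _) _.
  by apply: ler_wiXn2l; rewrite ?invr_ge0 ?invf_le1 ?ler1n //; lia.
have [a ua] := lim 0%N; have [b ub] := lim 1%N.
exists (a + b) => U U0; have [V [_ V0 _ VU]] := nbhs0_half U0.
have [N hN] := cP _ V0.
have [A [B [aA bB AB]]] := nbhs_add (translate_nbhs (a + b) V0).
have [N1 _ h1] := ua A aA; have [N2 _ h2] := ub B bB.
exists N => m Nm; pose j := maxn N (maxn N1 N2).
have -> : P m - (a + b) = (P m - P (k j.*2)) + (P (k j.*2) - (a + b)) by zmod.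
apply: VU.
  apply: hN => //; apply: leq_trans (kj _); rewrite -addnn.
  by apply: leq_trans (leq_addr _ _); rewrite leq_maxl.
rewrite -uw; have [<- _ _] := stS j.*2; apply: AB.
  by have := h1 j; rewrite /= add0n; apply; rewrite /j !leq_max leqnn orbT.
by have := h2 j; rewrite /= add1n; apply; rewrite /j !leq_max leqnn !orbT.
Qed.

Lemma polish_nbhs_base : exists W : nat -> set X,
  (forall n, nbhs 0 (W n)) /\ forall U, nbhs 0 U -> exists n, W n `<=` U.
Proof.
have [_ [d [_ dind _]]] := polish_X.
exists (fun n => [set x | d 0 x < n.+1%:R^-1]); split.
  by move=> n; apply/dind; exists n.+1%:R^-1; rewrite ?invr_gt0.
move=> U /dind[e e0 eU]; exists (Num.truncn e^-1) => x /= dx; apply: eU => /=.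
by apply: lt_trans dx _; rewrite invf_plt ?posrE // truncnS_gt.
Qed.

Lemma polish_separated x : (forall U, nbhs 0 U -> U x) -> x = 0.
Proof.
have [_ [d [[d0 dC dT] dind _]]] := polish_X => h; apply/esym/d0/eqP.
have dx0 : 0 <= d 0 x.
  have := dT 0 x 0; rewrite (dC x) (_ : d 0 0 = 0); first by lra.
  exact/d0.
rewrite eq_le dx0 andbT leNgt; apply/negP => dx.
have /h /= : nbhs 0 [set y | d 0 y < d 0 x] by apply/dind; exists (d 0 x).
by rewrite ltxx.
Qed.

(** An ultrafilter on A contains arbitrarily small translates; their centres form
    a Cauchy sequence, and its limit is the limit of the ultrafilter. *)
Lemma totally_bounded_compact A : closed A ->
  (forall V, nbhs 0 V -> exists F : seq X, forall a, A a -> exists2 y, y \in F & V (a - y)) ->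
  compact A.
Proof.
move=> cA tb; rewrite compact_ultra => G GU GA.
have cover (F : seq X) V : G [set a | exists2 y, y \in F & V (a - y)] ->
    exists y, G [set a | V (a - y)].
  elim: F => [|y F IH] GF.
    by have [a [b]] := @filter_ex _ G _ _ GF; rewrite in_nil.
  have [Gy|Gy] := in_ultra_setVsetC [set a | V (a - y)] GU; first by exists y.
  apply: IH; apply: filterS (filterI GF Gy) => a [[z]].
  by rewrite inE => /orP[/eqP->//|zF Va] _; exists z.
have [W [W0 Wb]] := polish_nbhs_base.
have /choice[y yP] : forall n, exists y, G [set a | forall i, (i <= n)%N -> W i (a - y)].
  move=> n; have Wn0 : nbhs 0 [set v | forall i, (i <= n)%N -> W i v].
    elim: n => [|n IH].
      by apply: filterS (W0 0%N) => v W0v i; rewrite leqn0 => /eqP->.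
    apply: filterS (filterI IH (W0 n.+1)) => v [h Wv] i.
    by rewrite leq_eqVlt => /orP[/eqP->//|/h].
  have [F FP] := tb _ Wn0; apply: (cover F [set v | forall i, (i <= n)%N -> W i v]).
  by apply: filterS GA => a /FP.
have close U : nbhs 0 U -> exists N, forall m, (N <= m)%N -> G [set a | U (a - y m)].
  move=> /Wb[N NU]; exists N => p Np; apply: filterS (yP p) => a h; exact/NU/h.
have cy : cauchy_seq y.
  move=> U /nbhs0_half[V [_ V0 Vs VU]]; have [N hN] := close V V0.
  exists N => m n Nm Nn; have [a [/= Va Va']] := @filter_ex _ G _ _ (filterI (hN m Nm) (hN n Nn)).
  have -> : y m - y n = - (a - y m) + (a - y n) by zmod.
  by apply: VU => //; exact: Vs.
have [z yz] := cauchy_converges cy.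
have Gz : G --> z.
  move=> U /nbhs_translate /nbhs0_half[V [_ V0 _ VU]].
  have [N hN] := close V V0; have [N' hN'] := yz V V0; pose m := maxn N N'.
  apply: filterS (hN m (leq_maxl _ _)) => a /= Va.
  have := VU _ _ Va (hN' m (leq_maxr _ _)) => /=.
  by have -> : z + (a - y m + (y m - z)) = a by zmod.
exists z; split=> //; apply: cA => U /Gz GUz.
exact: (@filter_ex _ G _ _ (filterI GA GUz)).
Qed.

(** Otherwise a closed neighbourhood inside U, together with its translates,
    would be totally bounded, hence compact. *)
Lemma not_totally_bounded U : ~ locally_compact [set: X] -> nbhs 0 U ->
  exists2 V, nbhs 0 V & forall F : seq X, exists2 x, U x & forall y, y \in F -> ~ V (x - y).
Proof.
move=> nlc U0; apply: contrapT => h; apply: nlc.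
have [A [cA A0 _ AU]] := nbhs0_half U0.
have {}AU a : A a -> U a by move=> Aa; rewrite -(addr0 a); apply: AU => //; exact: nbhs_singleton.
move=> x _; exists [set a | A (a - x)].
  by apply: filterS (translate_nbhs x A0).
have cAx : closed [set a | A (a - x)].
  move=> a ha; apply: cA => W /nbhs_translate W0.
  have [b [Ab /= Wb]] := ha _ (translate_nbhs a W0).
  by exists (b - x); split=> //; move: Wb; rewrite (_ : a - x + (b - a) = b - x) //; zmod.
split=> //; apply: totally_bounded_compact => // V V0.
apply: contrapT => nF; apply: h; exists V => // F.
have /existsNP[a /not_implyP[Aa hF]] : ~ forall a, A (a - x) ->
    exists2 y, y \in [seq y + x | y <- F] & V (a - y).
  by move=> hF; apply: nF; exists [seq y + x | y <- F].
exists (a - x); first exact: AU.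
move=> y yF Vy; apply: hF; exists (y + x); first exact: map_f.
by have -> : a - (y + x) = a - x - y by zmod.
Qed.

End complete.
End topological_group.

(** * Chains of neighbourhoods and series *)

(** A base of neighbourhoods at 0 adapted to sums, in which no term is covered by
    finitely many translates of the next one.  The last property is where the
    failure of local compactness enters: it leaves room to move away from any
    given finite set of translates while adding only small terms. *)
Record thin_chain (X : topologicalZmodType) (T : nat -> set X) : Prop := ThinChain {
  chain_closed : forall n, closed (T n);
  chain_nbhs : forall n, nbhs 0 (T n);
  chain_opp : forall n x, T n x -> T n (- x);
  chain_half : forall n x y, T n.+1 x -> T n.+1 y -> T n (x + y);
  chain_base : forall U, nbhs 0 U -> exists n, T n `<=` U;
  chain_escape : forall n (F : seq X),
    exists2 x, T n x & forall y, y \in F -> ~ T n.+1 (x - y) }.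

Lemma thin_chain_exists (R : realType) (X : topologicalZmodType) :
  polish R X -> ~ locally_compact [set: X] -> exists T : nat -> set X, thin_chain T.
Proof.
move=> pX nlc; have [W [W0 Wb]] := polish_nbhs_base pX.
have /choice[next nextP] : forall a : nat * set X, exists V : set X, nbhs 0 a.2 ->
  [/\ closed V, nbhs 0 V, forall x, V x -> V (- x), (forall x y, V x -> V y -> a.2 (x + y)) /\ V `<=` W a.1 &
    forall F : seq X, exists2 x, a.2 x & forall y, y \in F -> ~ V (x - y)].
  move=> [n U] /=; have [U0|nU] := pselect (nbhs 0 U); last by exists U.
  have [V' V'0 esc] := not_totally_bounded pX nlc U0.
  have [V [cV V0 Vs VU]] := nbhs0_half (filterI (filterI U0 V'0) (W0 n)).
  have V00 : V 0 := nbhs_singleton V0.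
  have VUW x : V x -> ((U `&` V') `&` W n) x.
    by move=> Vx; rewrite -(addr0 x); exact: VU.
  exists V => _; split=> //.
    by split=> [x y Vx Vy|x /VUW[]//]; have [[]] := VU _ _ Vx Vy.
  move=> F; have [x Ux xF] := esc F; exists x => // y yF /VUW[[_ Vy] _].
  exact: (xF y).
pose T := fix T n := if n is m.+1 then next (m, T m) else next (0%N, setT).
have T0 n : nbhs 0 (T n).
  elim: n => [|n IH] /=; first by have [] := nextP (0%N, setT) filterT.
  by have [] := nextP (n, T n) IH.
have TP n : [/\ closed (T n), forall x, T n x -> T n (- x),
    forall x y, T n.+1 x -> T n.+1 y -> T n (x + y), T n.+1 `<=` W n &
    forall F : seq X, exists2 x, T n x & forall y, y \in F -> ~ T n.+1 (x - y)].
  have [_ _ _ [h1 h2] h3] := nextP (n, T n) (T0 n); split=> //.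
    by case: n {h1 h2 h3} => [|n]; [case: (nextP (0%N, setT) filterT)|case: (nextP (n, T n) (T0 n))].
  by case: n {h1 h2 h3} => [|n]; [case: (nextP (0%N, setT) filterT)|case: (nextP (n, T n) (T0 n))].
exists T; split=> [n|//|n|n|U U0|n]; try by case: (TP n).
have [n WU] := Wb U U0; exists n.+1; apply: subset_trans WU; by case: (TP n).
Qed.

Section chain.
Variables (R : realType) (X : topologicalZmodType) (T : nat -> set X).
Hypotheses (polish_X : polish R X) (chain_T : thin_chain T).

Lemma chain0 n : T n 0.
Proof. by apply: nbhs_singleton; exact: (chain_nbhs chain_T). Qed.

Lemma chain_le m n x : (m <= n)%N -> T n x -> T m x.
Proof.
move=> /subnK<-; elim: (n - m)%N x => // k IH x Tx; apply: IH.
by rewrite -(addr0 x); apply: (chain_half chain_T) => //; exact: chain0.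
Qed.

Lemma chainD k m n x y : (k < m)%N -> (k < n)%N -> T m x -> T n y -> T k (x + y).
Proof. by move=> km kn /(chain_le km) + /(chain_le kn); exact: chain_half. Qed.

Lemma chainB k m n x y : (k < m)%N -> (k < n)%N -> T m x -> T n y -> T k (x - y).
Proof. by move=> km kn Tx /(chain_opp chain_T); exact: chainD Tx. Qed.

Lemma chain_separated x : (forall n, T n x) -> x = 0.
Proof.
move=> Tx; apply: (polish_separated polish_X) => U.
by move=> /(chain_base chain_T)[n]; apply.
Qed.

Lemma converges_unique (P : nat -> X) z z' : converges P z -> converges P z' -> z = z'.
Proof.
move=> Pz Pz'; apply/eqP; rewrite -subr_eq0; apply/eqP/chain_separated => n.
have [N h] := Pz _ (chain_nbhs chain_T n.+1); have [N' h'] := Pz' _ (chain_nbhs chain_T n.+1).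
have -> : z - z' = (P (maxn N N') - z') - (P (maxn N N') - z) by zmod.
by apply: chainB (h' _ _) (h _ _); rewrite ?leq_maxl ?leq_maxr.
Qed.

Definition psum (y : nat -> X) n := \sum_(i < n) y i.
Definition infsum (y : nat -> X) : X := xget 0 [set z | converges (psum y) z].
(** Level i of a series has the six indices from 6 * i to 6 * i + 5 for itself:
    remainders after n terms lie in T (6 * n) (infsum_tail), and adding up
    several of them costs a few indices without reaching those used at the
    preceding level. *)
Definition small_terms (y : nat -> X) := forall i, (0 < i)%N -> T (6 * i).+1 (y i).

Lemma psumS y n : psum y n.+1 = psum y n + y n.
Proof. by rewrite /psum big_ord_recr. Qed.

Lemma psum_agree y y' n : agree n y y' -> psum y n = psum y' n.
Proof. by move=> yy; apply: eq_bigr => i _; exact: yy. Qed.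

Lemma psum_tail y n m : small_terms y -> (0 < n)%N -> (n <= m)%N -> T (6 * n) (psum y m - psum y n).
Proof.
move=> sy + /subnK<-; move: (m - n)%N => k; elim: k n => [|k IH] n n0.
  by rewrite subrr; exact: chain0.
have -> : psum y (k.+1 + n) - psum y n = y n + (psum y (k + n.+1) - psum y n.+1).
  by rewrite psumS addnS addSn; zmod.
by apply: chainD (sy n n0) (IH _ _) => //; lia.
Qed.

Lemma infsum_converges y : small_terms y -> converges (psum y) (infsum y).
Proof.
move=> sy; rewrite /infsum; case: xgetP => [_ _ //|nz]; exfalso.
have [|z] := @cauchy_converges X R polish_X (psum y); last exact: nz.
move=> U /(chain_base chain_T)[k kU]; exists k.+1 => m n km kn; apply: kU.
have -> : psum y m - psum y n = (psum y m - psum y k.+1) - (psum y n - psum y k.+1) by zmod.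
apply: chainB (psum_tail sy _ km) (psum_tail sy _ kn) => //; lia.
Qed.

Lemma infsum_tail y n : small_terms y -> (0 < n)%N -> T (6 * n) (infsum y - psum y n).
Proof.
move=> sy n0; apply: (chain_closed chain_T) => U /nbhs_translate U0.
have [N hN] := infsum_converges sy U0; exists (psum y (maxn n N) - psum y n); split.
  by apply: psum_tail => //; rewrite leq_maxl.
have := hN _ (leq_maxr n N) => /=.
by have -> : infsum y - psum y n + (psum y (maxn n N) - infsum y) = psum y (maxn n N) - psum y n by zmod.
Qed.

Lemma infsum_agree y y' n : small_terms y -> small_terms y' -> agree n.+1 y y' ->
  T n (infsum y - infsum y').
Proof.
move=> sy sy' yy; have -> : infsum y - infsum y' =
    (infsum y - psum y n.+1) - (infsum y' - psum y' n.+1).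
  by rewrite (psum_agree yy); zmod.
by apply: chainB (infsum_tail sy _) (infsum_tail sy' _) => //; lia.
Qed.

End chain.

(** * Maps on the Cantor space *)

Lemma nbhs_cylinder (x : cantor_space) n : nbhs x (cylinder x n).
Proof.
elim: n => [|n IH]; first by apply: filterS filterT.
have xn : nbhs x (proj n @^-1` [set x n] : set cantor_space).
  by apply: proj_continuous; exact: discrete_set1.
apply: filterS (filterI IH xn) => y [xy yn] i.
by rewrite ltnS leq_eqVlt => /orP[/eqP->|/xy].
Qed.

Section cantor_group.
Variable X : topologicalZmodType.

Lemma agree_continuous (f : cantor_space -> X) :
  (forall t U, nbhs 0 U -> exists n, forall t', agree n t t' -> U (f t' - f t)) -> continuous f.
Proof.
move=> h t A /nbhs_translate A0; have [n hn] := h t _ A0.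
apply: filterS (nbhs_cylinder t n) => t' tt'; have /= := hn t' _.
rewrite addrCA subrr addr0; apply => i /tt'.
by [].
Qed.

Lemma uniformly_continuous_cantor (f : cantor_space -> X) (U : set X) : continuous f -> nbhs 0 U ->
  exists n, forall t t', agree n t t' -> U (f t - f t').
Proof.
move=> cf /nbhs0_half[V [_ V0 Vs VU]].
have := compact_near_coveringP [set: cantor_space]; case=> + _.
move=> /(_ cantor_space_compact nat \oo
  (fun n t => forall t', agree n t t' -> U (f t - f t'))) [t _|N _ hN]; last first.
  by exists N => t t'; exact: (hN N (leqnn N) t I).
have [n hn] := cylinder_nbhs (cf t _ (translate_nbhs (f t) V0)).
exists (cylinder t n, [set m | (n <= m)%N]); first by split; [exact: nbhs_cylinder|exists n].
move=> [t0 m] /= [tt0 nm] t' t0t'.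
have -> : f t0 - f t' = (f t0 - f t) + - (f t' - f t) by zmod.
apply: VU; first exact: (hn t0).
by apply: Vs; apply: (hn t') => i ni; rewrite -t0t' ?tt0 // (leq_trans ni).
Qed.

End cantor_group.

(** * A separated family of compact sets *)

Lemma dense_sequence (R : realType) (X : topologicalZmodType) : polish R X ->
  exists e : nat -> X, forall x U, nbhs 0 U -> exists n, U (x - e n).
Proof.
move=> [[D /countable_injP[f fI] dD] _].
have /choice[e eP] : forall n, exists x, forall y, D y -> f y = n -> x = y.
  move=> n; have [[y Dy yn]|h] := pselect (exists2 y, D y & f y = n); last first.
    by exists 0 => y Dy yn; case: h; exists y.
  by exists y => z Dz zn; apply: fI; rewrite ?inE // zn.
exists e => x U /nbhs_opp; rewrite oppr0 => /(translate_nbhs x) U0.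
have [y [/interior_subset /= Uy Dy]] : ([set y | U (- (y - x))])^° `&` D !=set0.
  by apply: dD; [exists x; exact: U0|exact: open_interior].
by exists (f y); rewrite (eP (f y) y) // -opprB.
Qed.

Section borel.
Variable X : topologicalType.

Lemma borelC (A : set X) : borel A -> borel (~` A).
Proof.
move=> bA; have [_ h _] := smallest_sigma_algebra setT (@open X).
by rewrite -setTD; exact: (h A bA).
Qed.

Lemma borel_bigcup (A : nat -> set X) : (forall n, borel (A n)) -> borel (\bigcup_n A n).
Proof.
move=> bA; have [_ _ h] := smallest_sigma_algebra setT (@open X).
exact: (h A bA).
Qed.

Lemma borel_bigcap (A : nat -> set X) : (forall n, borel (A n)) -> borel (\bigcap_n A n).
Proof.
move=> h; rewrite -(setCK (\bigcap_n A n)) setC_bigcap.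
by apply: borelC; apply: borel_bigcup => n; exact: borelC.
Qed.

Lemma borel_closed (A : set X) : closed A -> borel A.
Proof.
move=> cA; rewrite -(setCK A); apply: borelC.
apply: (@sub_gen_smallest _ (sigma_algebra setT) (@open X)).
exact: closed_openC.
Qed.

End borel.

Section construction.
Variables (R : realType) (X : topologicalZmodType) (T : nat -> set X) (e : nat -> X).
Hypotheses (polish_X : polish R X) (chain_T : thin_chain T).
Hypothesis dense_e : forall x U, nbhs 0 U -> exists n, U (x - e n).

(* Locally constant maps with values in the range of e: a depth m and a table. *)
Notation code := {m : nat & {ffun m.-tuple bool -> nat}}.

Definition step (c : code) (t : nat -> bool) : X :=
  e (tagged c [tuple t i | i < tag c]).

Definition code_of (k : nat) : code :=
  if unpickle k is Some (c, j) then let _ : nat := j in c else existT _ 0%N [ffun=> 0%N].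
(** A free label, which provides each step function with infinitely many codes. *)
Definition tag_of (k : nat) : nat :=
  if unpickle k is Some (c, j) then let _ : code := c in j else 0%N.

(** From level 1 on, step functions with large values are replaced by 0, so that
    every sequence of codes yields a convergent series. *)
Definition stepval i k t : X :=
  if (i == 0%N) || `[< forall t, T (6 * i).+2 (step (code_of k) t) >]
  then step (code_of k) t else 0.

Definition stepvals k : seq X :=
  0 :: [seq e (tagged (code_of k) b) | b : (tag (code_of k)).-tuple bool].

Lemma mem_stepvals i k t : stepval i k t \in stepvals k.
Proof.
rewrite /stepval; case: ifP => _; rewrite inE ?eqxx // /step; apply/orP; right.
by apply/codomP; eexists.
Qed.

Lemma stepval_small i k t : (0 < i)%N -> T (6 * i).+2 (stepval i k t).
Proof.
rewrite /stepval lt0n => /negbTE->; case: ifP => [/asboolP//|_]; exact: (chain0 chain_T).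
Qed.

Lemma stepval_local i k : exists m, forall t t', agree m t t' -> stepval i k t = stepval i k t'.
Proof.
exists (tag (code_of k)) => t t' tt'; rewrite /stepval /step.
suff -> : [tuple t i | i < tag (code_of k)] = [tuple t' i | i < tag (code_of k)] by [].
by apply: eq_from_tnth => j; rewrite !tnth_mktuple tt'.
Qed.

(** The injective test map phi sums some of the a i, each of which is too large
    to be compensated by the later ones. *)
Lemma bump_exists : exists a : nat -> X, forall i, T (6 * i).+1 (a i) /\ ~ T (6 * i + 5) (a i).
Proof.
suff /choice[a aP] : forall i, exists a, T (6 * i).+1 a /\ ~ T (6 * i + 5) a by exists a.
move=> i; have [x Tx /(_ 0)] := chain_escape chain_T (6 * i).+1 [:: 0].
rewrite inE eqxx subr0 => /(_ isT) nT; exists x; split=> //.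
by move=> /(chain_le chain_T) - /(_ (6 * i).+2) h; apply: nT; apply: h; lia.
Qed.

Variable a : nat -> X.
Hypothesis aP : forall i, T (6 * i).+1 (a i) /\ ~ T (6 * i + 5) (a i).

Definition bump (w : nat -> bool) j := if w j then a j else 0.

Fixpoint bumpsums i : seq X := if i is i'.+1
  then bumpsums i' ++ [seq f + a i | f <- bumpsums i'] else [:: 0; a 0%N].

Lemma mem_bumpsums w i : psum (bump w) i.+1 \in bumpsums i.
Proof.
elim: i => [|i IH]; rewrite psumS.
  by rewrite /psum big_ord0 add0r /bump /=; case: (w 0%N); rewrite !inE eqxx ?orbT.
have [->|->] : bump w i.+1 = 0 \/ bump w i.+1 = a i.+1.
- by rewrite /bump; case: (w i.+1); [right|left].
- by rewrite addr0 mem_cat IH.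
- by rewrite mem_cat; apply/orP; right; apply/mapP; exists (psum (bump w) i.+1).
Qed.

Lemma bump_small w : small_terms T (bump w).
Proof. by move=> i _; rewrite /bump; case: (w i); [case: (aP i)|exact: (chain0 chain_T)]. Qed.

(** The shift at level i for the code k must not differ from the shift of a
    smaller code by one of these finitely many elements, up to T (6 * i + 3). *)
Definition clashes i k : seq X :=
  [seq p - q | p <- [seq p - q | p <- flatten [seq stepvals l | l <- iota 0 k], q <- stepvals k],
               q <- [seq f' - f | f' <- bumpsums i, f <- bumpsums i]].

Lemma escape_exists : exists esc : nat -> seq X -> X, forall i F,
  T (6 * i).+2 (esc i F) /\ forall y, y \in F -> ~ T (6 * i).+3 (esc i F - y).
Proof.
have /choice[g gP] : forall p : nat * seq X, exists x,
    T (6 * p.1).+2 x /\ forall y, y \in p.2 -> ~ T (6 * p.1).+3 (x - y).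
  by move=> [i F]; have [x Tx xF] := chain_escape chain_T (6 * i).+2 F; exists x.
by exists (fun i F => g (i, F)) => i F; exact: (gP (i, F)).
Qed.

Variable esc : nat -> seq X -> X.
Hypothesis escP : forall i F,
  T (6 * i).+2 (esc i F) /\ forall y, y \in F -> ~ T (6 * i).+3 (esc i F - y).

Fixpoint shifts i k : seq X := if k is l.+1
  then rcons (shifts i l) (esc i [seq y + o | y <- shifts i l, o <- clashes i l]) else [::].
Definition shift i k := esc i [seq y + o | y <- shifts i k, o <- clashes i k].

Lemma mem_shifts i l k : (l < k)%N -> shift i l \in shifts i k.
Proof.
elim: k => // k IH; rewrite ltnS leq_eqVlt /= mem_rcons inE => /orP[/eqP->|/IH->].
  by rewrite eqxx.
by rewrite orbT.
Qed.

Definition term (c : nat -> nat) (t : nat -> bool) i := stepval i (c i) t + shift i (c i).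

Lemma term_small c t : small_terms T (term c t).
Proof.
move=> i i0; apply: (chainD chain_T (m := (6 * i).+2) (n := (6 * i).+2)) => //.
  exact: stepval_small.
by case: (escP i [seq y + o | y <- shifts i (c i), o <- clashes i (c i)]).
Qed.

Lemma shift_clash i k l t t' f f' : (l < k)%N -> f \in bumpsums i -> f' \in bumpsums i ->
  ~ T (6 * i).+3 (stepval i k t + shift i k - (stepval i l t' + shift i l) - f + f').
Proof.
move=> lk fi fi'.
have -> : stepval i k t + shift i k - (stepval i l t' + shift i l) - f + f' =
  shift i k - (shift i l + (stepval i l t' - stepval i k t - (f' - f))) by zmod.
have [_] := escP i [seq y + o | y <- shifts i k, o <- clashes i k]; apply.
apply: allpairs_f; first exact: mem_shifts.
apply: allpairs_f; last exact: allpairs_f.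
apply: allpairs_f; last exact: mem_stepvals.
by apply/flatten_mapP; exists l; [rewrite mem_iota|exact: mem_stepvals].
Qed.

Lemma term_clash i c c' t t' f f' : c i <> c' i -> f \in bumpsums i -> f' \in bumpsums i ->
  ~ T (6 * i).+3 (term c t i - term c' t' i - f + f').
Proof.
move=> /eqP; rewrite neq_ltn => /orP[lt|lt] fi fi'; last exact: shift_clash.
move=> /(chain_opp chain_T) h; apply: (shift_clash (t := t') (t' := t) lt fi' fi).
by move: h; rewrite (_ : - _ = term c' t' i - term c t i - f' + f) //; zmod.
Qed.

Definition ev c t := infsum (term c t).
Definition phi (w : cantor_space) : X := infsum (bump w).

(** If two points differ by a difference of values of phi, then their expansions
    cannot part at a level i where the preceding sums coincide: all remainders
    are in T (6 * i + 5) and the partial sums of phi are among finitely many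
    elements, so that the terms at level i would violate term_clash. *)
Lemma first_difference n i z z' c c' t t' w w' : (i < n)%N -> c i <> c' i ->
  z - z' = phi w - phi w' ->
  T (6 * n) (z - psum (term c t) n) -> T (6 * n) (z' - psum (term c' t') n) ->
  psum (term c t) i = psum (term c' t') i -> False.
Proof.
move=> lin cc zz zc zc' pp.
apply: (term_clash (t := t) (t' := t') cc (mem_bumpsums w i) (mem_bumpsums w' i)).
have near z1 c1 t1 : T (6 * n) (z1 - psum (term c1 t1) n) -> T (6 * i + 5) (z1 - psum (term c1 t1) i.+1).
  move=> h; rewrite (_ : _ - _ = z1 - psum (term c1 t1) n +
    (psum (term c1 t1) n - psum (term c1 t1) i.+1)); last by zmod.
  by apply: (chainD chain_T) h (psum_tail chain_T (@term_small c1 t1) _ lin); lia.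
have nearphi w1 : T (6 * i.+1) (phi w1 - psum (bump w1) i.+1).
  exact: (infsum_tail polish_X chain_T (@bump_small w1)).
have -> : term c t i - term c' t' i - psum (bump w) i.+1 + psum (bump w') i.+1 =
  (z' - psum (term c' t') i.+1 - (z - psum (term c t) i.+1)) +
  (phi w - psum (bump w) i.+1 - (phi w' - psum (bump w') i.+1)).
  rewrite !(psumS (term _ _)) pp.
  transitivity (term c t i - term c' t' i - psum (bump w) i.+1 + psum (bump w') i.+1
     - (z - z') + (phi w - phi w')); last by zmod.
  by rewrite zz; zmod.
apply: (chainD chain_T (m := (6 * i + 4)%N) (n := (6 * i + 4)%N)); try lia.
  by apply: (chainB chain_T) (near _ _ _ zc') (near _ _ _ zc); lia.
by apply: (chainB chain_T) (nearphi w) (nearphi w'); lia.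
Qed.

Lemma phi_injective : injective phi.
Proof.
move=> w w' e0; apply: contrapT => ww.
have /existsNP[n wn] : ~ forall n, w n = w' n by move=> /funext.
have [|i wi mi] := @ex_minnP (fun n => w n != w' n); first by exists n; apply/eqP.
have ag : agree i (bump w) (bump w').
  move=> j ji; rewrite /bump; have -> // : w j = w' j.
  by apply/eqP; apply: contraTT ji => /mi; rewrite -leqNgt.
have nearphi w1 : T (6 * i.+1) (phi w1 - psum (bump w1) i.+1).
  exact: (infsum_tail polish_X chain_T (@bump_small w1)).
have key w1 w2 : phi w1 = phi w2 -> agree i (bump w1) (bump w2) -> w1 i = true -> w2 i = false -> False.
  move=> e1 ag1 w1i w2i; have [_] := aP i; apply.
  have -> : a i = (phi w2 - psum (bump w2) i.+1) - (phi w1 - psum (bump w1) i.+1).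
    rewrite e1 !psumS (psum_agree ag1) /bump w1i w2i; zmod.
  by apply: (chainB chain_T) (nearphi w2) (nearphi w1); lia.
case w1 : (w i); case w2 : (w' i); move: wi; rewrite w1 w2 // => _.
  exact: (key w w').
by apply: (key w' w) => //; exact: agree_sym.
Qed.

Lemma phi_continuous : continuous phi.
Proof.
apply: agree_continuous => w U /(chain_base chain_T)[n nU]; exists n.+1 => w' ww.
apply: nU; apply: (infsum_agree polish_X chain_T) (@bump_small w') (@bump_small w) _ => i ni.
by rewrite /bump -(ww i).
Qed.

Lemma ev_continuous c t U : nbhs 0 U ->
  exists n, forall c' t', agree n c c' -> agree n t t' -> U (ev c' t' - ev c t).
Proof.
move=> /(chain_base chain_T)[n nU].
have /choice[m mP] : forall i, exists m, forall t t', agree m t t' -> stepval i (c i) t = stepval i (c i) t'.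
  by move=> i; exact: stepval_local.
exists (maxn n.+1 (\max_(i < n.+1) m i)) => c' t' cc tt.
apply: nU; apply: (infsum_agree polish_X chain_T) (@term_small c' t') (@term_small c t) _ => i ni.
rewrite /term -(cc i) ?(leq_trans ni) ?leq_maxl // (mP i t' t) //.
apply: agree_sym; apply: agreeW tt; rewrite leq_max; apply/orP; right.
exact: (@leq_bigmax _ (fun i : 'I_n.+1 => m i) (Ordinal ni)).
Qed.

(** A Borel hull of the values ev c t for fixed t.  The codes are chosen
    separately at each level, which makes the set a countable intersection of
    countable unions of closed sets. *)
Definition fiber t : set X :=
  [set z | forall n, exists s : seq nat, T (6 * n.+1) (z - psum (term (nth 0%N s) t) n.+1)].

Lemma ev_fiber c t : fiber t (ev c t).
Proof.
move=> n; exists (mkseq c n.+1); rewrite (@psum_agree _ _ (term c t)).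
  exact: (infsum_tail polish_X chain_T (@term_small c t)).
by move=> i ni; rewrite /term nth_mkseq.
Qed.

Lemma fiber_phi t y w w' : fiber t (phi w + y) -> fiber t (phi w' + y) -> w = w'.
Proof.
move=> h h'; apply: phi_injective; apply/eqP; rewrite -subr_eq0; apply/eqP.
apply: (chain_separated polish_X chain_T) => n.
have [s hs] := h n; have [s' hs'] := h' n.
have zz : phi w + y - (phi w' + y) = phi w - phi w' by zmod.
have [ss|nss] := pselect (agree n.+1 (nth 0%N s) (nth 0%N s')).
  rewrite -zz (_ : _ - _ = (phi w + y - psum (term (nth 0%N s) t) n.+1) -
     (phi w' + y - psum (term (nth 0%N s') t) n.+1)).
    by apply: (chainB chain_T) hs hs'; lia.
  rewrite (@psum_agree _ (term (nth 0%N s) t) (term (nth 0%N s') t)); first by zmod.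
  by move=> i /ss; rewrite /term => ->.
have [|i /andP[ni /eqP si] mi] := @ex_minnP (fun i => (i < n.+1)%N && (nth 0%N s i != nth 0%N s' i)).
  move: nss => /existsNP[i /not_implyP[ni /eqP si]]; exists i; exact/andP.
exfalso; apply: (first_difference ni si zz hs hs'); apply: psum_agree => j ji.
rewrite /term; have -> // : nth 0%N s j = nth 0%N s' j.
apply/eqP; apply: contraTT ji => sj; rewrite -leqNgt.
by have [jn|nj] := ltnP j n.+1; [apply: mi; rewrite jn|lia].
Qed.

Lemma step_approx (psi : cantor_space -> X) n j : continuous psi ->
  exists k, tag_of k = j /\ forall t, T n (psi t - step (code_of k) t).
Proof.
move=> cpsi; have [m hm] := uniformly_continuous_cantor cpsi (chain_nbhs chain_T n.+1).
pose ext (b : m.-tuple bool) : cantor_space := nth false b.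
have /choice[d dP] : forall b, exists d, T n.+1 (psi (ext b) - e d).
  by move=> b; exact: dense_e (chain_nbhs chain_T n.+1).
pose c : code := existT _ m [ffun b => d b].
exists (pickle (c, j)); rewrite /tag_of /code_of pickleK; split=> // t.
rewrite /step /= ffunE; set b := [tuple t i | i < m].
rewrite (_ : _ - _ = (psi t - psi (ext b)) + (psi (ext b) - e (d b))); last by zmod.
apply: (chain_half chain_T) => //; apply: hm => i im.
by rewrite /ext (nth_map (Ordinal im)) ?size_enum_ord // nth_enum_ord.
Qed.

Lemma step_continuous c : continuous (step c : cantor_space -> X).
Proof.
apply: agree_continuous => t U U0; exists (tag c) => t' tt'.
rewrite (_ : step c t' = step c t) ?subrr; first exact: nbhs_singleton.
rewrite /step; congr (e (tagged c _)); apply: eq_from_tnth => j.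
by rewrite !tnth_mktuple tt'.
Qed.

(** Approximate psi by a step function, then the remainder by a smaller one, and
    so on.  The step values add up to psi, and the shifts, which depend only on
    the codes, add up to a constant. *)
Lemma ev_universal (psi : cantor_space -> X) j : continuous psi ->
  exists c x, tag_of (c 0%N) = j /\ forall t, ev c t = psi t + x.
Proof.
move=> cpsi.
have /choice[app appP] : forall p : nat * (cantor_space -> X), exists k, continuous p.2 ->
    tag_of k = j /\ forall t, T (6 * p.1.+1).+3 (p.2 t - step (code_of k) t).
  move=> [i r]; have [cr|ncr] := pselect (continuous r); last by exists 0%N.
  by have [k hk] := step_approx (6 * i.+1).+3 j cr; exists k.
pose r := fix r i := if i is i'.+1 then fun t => r i' t - step (code_of (app (i', r i'))) t else psi.
pose c i := app (i, r i).
have rc i : continuous (r i).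
  elim: i => //= i IH t; apply: (@agree_continuous X) => {}t U U0.
  have [V [_ V0 Vs VU]] := nbhs0_half U0.
  have [n hn] := cylinder_nbhs (IH t _ (translate_nbhs _ V0)).
  have [m hm] := cylinder_nbhs (@step_continuous (code_of (c i)) t _ (translate_nbhs _ V0)).
  exists (maxn n m) => t' tt'.
  set s := step (code_of (app (i, r i))).
  rewrite (_ : _ - _ = (r i t' - r i t) + - (s t' - s t)); last by zmod.
  apply: VU; first by apply: hn => k kn; rewrite -tt' // leq_max kn.
  by apply: Vs; apply: hm => k km; rewrite -tt' // leq_max km orbT.
have rP i : tag_of (c i) = j /\ forall t, T (6 * i.+1).+3 (r i.+1 t) by exact: (appP (i, r i) (rc i)).
have rS i t : r i.+1 t = r i t - step (code_of (c i)) t by [].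
have stepE i t : stepval i (c i) t = r i t - r i.+1 t.
  have E : step (code_of (c i)) t = r i t - r i.+1 t by rewrite rS; zmod.
  rewrite /stepval; case: ifP => // /negbT/norP[i0 /asboolPn[]] t'.
  have -> : step (code_of (c i)) t' = r i t' - r i.+1 t' by rewrite rS; zmod.
  case: i i0 {E} => // i _; have [_ h] := rP i; have [_ h'] := rP i.+1.
  by apply: (chainB chain_T) (h t') (h' t'); lia.
have shift_small : small_terms T (fun i => shift i (c i)).
  move=> i _; apply: (chain_le chain_T (n := (6 * i).+2)) => //.
  by case: (escP i [seq y + o | y <- shifts i (c i), o <- clashes i (c i)]).
exists c, (infsum (fun i => shift i (c i))); split=> [|t]; first by case: (rP 0%N).
apply: (converges_unique polish_X chain_T) (infsum_converges polish_X chain_T (@term_small c t)) _.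
move=> U U0; have [V [_ V0 Vs VU]] := nbhs0_half U0.
have [n nV] := chain_base chain_T V0.
have [N hN] := infsum_converges polish_X chain_T shift_small V0.
exists (maxn N n.+1) => m; rewrite geq_max => /andP[Nm nm].
have psumE k : psum (term c t) k = psi t - r k t + psum (fun i => shift i (c i)) k.
  elim: k => [|k IH]; first by rewrite /psum !big_ord0 /=; zmod.
  by rewrite !psumS IH {1}/term stepE; zmod.
rewrite psumE (_ : _ - _ = - r m t +
  (psum (fun i => shift i (c i)) m - infsum (fun i => shift i (c i)))); last by zmod.
apply: VU; last exact: hN.
apply: Vs; apply: nV; case: m nm {Nm psumE} => // m nm.
by have [_ h] := rP m; apply: (chain_le chain_T) (h t); lia.
Qed.

Lemma fiber_borel t : borel (fiber t).
Proof.
have -> : fiber t = \bigcap_n \bigcup_k [set z | exists2 s : seq nat,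
    pickle s = k & T (6 * n.+1) (z - psum (term (nth 0%N s) t) n.+1)].
  apply/seteqP; split=> z h n => [_|].
    by have [s hs] := h n; exists (pickle s) => //; exists s.
  by have [k _ [s _ hs]] := h n I; exists s.
apply: borel_bigcap => n; apply: borel_bigcup => k.
have [[s <-]|ns] := pselect (exists s : seq nat, pickle s = k); last first.
  rewrite (_ : [set z | _] = set0); first by apply: borel_closed; exact: closed0.
  by rewrite -subset0 => z [s sk _]; apply: ns; exists s.
set x := psum (term (nth 0%N s) t) n.+1.
rewrite (_ : [set z | _] = [set z | T (6 * n.+1) (z - x)]); last first.
  apply/seteqP; split=> z; last by exists s.
  by move=> [s' /(pcan_inj pickleK) ->].
apply: borel_closed => z hz.
apply: (chain_closed chain_T) => U /nbhs_translate /(translate_nbhs z)/hz[y [Ty /= Uy]].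
by exists (y - x); split=> //; move: Uy; rewrite (_ : z - x + (y - z) = y - x) //; zmod.
Qed.

End construction.

(** * Cofinality *)

Lemma cantor_closed_set1 (w : cantor_space) : closed [set w].
Proof.
apply: accessible_closed_set1; apply: hausdorff_accessible.
exact: cantor_space_hausdorff.
Qed.

Lemma haar_cantor_set1 (R : realType) (w : cantor_space) : haar_cantor R [set w] = 0%E.
Proof.
have mw : measurable ([set w] : set cantor_borel).
  rewrite -(setCK [set w]); apply: measurableC; apply: sub_sigma_algebra.
  by apply: closed_openC; exact: cantor_closed_set1.
have le n : (haar_cantor R [set w] <= (2^-1 ^+ n)%:E)%E.
  rewrite -(haar_cantor_coin R w n); apply: le_measure; rewrite ?inE //.
    exact: measurable_cylinder.
  by move=> _ ->.
apply/eqP; rewrite eq_le measure_ge0 andbT; apply/lee_addgt0Pr => e e0; rewrite add0e.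
by have [N /ltW Ne] := half_pow_lt e0; apply: le_trans (le N) _; rewrite lee_fin.
Qed.

Section universal_family.
Variables (R : realType) (X : topologicalZmodType).

(** The family used for the lower bound.  Each c describes a continuous map
    ev c on the Cantor space, and every continuous map occurs up to translation
    (cat_universal), with any prescribed tag.  The values of all these maps at
    one parameter t lie in a Borel set fiber t that every translate of phi meets
    at most once (cat_thin).  No translate of phi meets the images of two maps
    with distinct tags (cat_apart). *)
Record catalogue (ev : (nat -> nat) -> (nat -> bool) -> X) (tag : nat -> nat)
    (phi : cantor_space -> X) (fiber : (nat -> bool) -> set X) : Prop := Catalogue {
  cat_phi : continuous phi;
  cat_ev : forall c t U, nbhs 0 U -> exists n, forall c' t',
    agree n c c' -> agree n t t' -> U (ev c' t' - ev c t);
  cat_universal : forall (psi : cantor_space -> X) j, continuous psi ->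
    exists c x, tag (c 0%N) = j /\ forall t, ev c t = psi t + x;
  cat_borel : forall t, borel (fiber t);
  cat_fiber : forall c t, fiber t (ev c t);
  cat_thin : forall t y w w', fiber t (phi w + y) -> fiber t (phi w' + y) -> w = w';
  cat_apart : forall c c' t t' y w w', tag (c 0%N) <> tag (c' 0%N) ->
    ev c t = phi w + y -> ev c' t' = phi w' + y -> False }.

Lemma catalogue_exists : polish R X -> ~ locally_compact [set: X] ->
  exists ev tag phi fiber, catalogue ev tag phi fiber.
Proof.
move=> pX nlc; have [T cT] := thin_chain_exists pX nlc.
have [e de] := dense_sequence pX.
have [a aP] := bump_exists cT; have [esc escP] := escape_exists cT.
exists (ev T e a esc), (@tag_of), (phi a), (fiber T e a esc); split.
- exact: (phi_continuous pX cT aP).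
- exact: (ev_continuous e pX cT a escP).
- exact: (ev_universal pX cT de a escP).
- exact: (fiber_borel e cT a esc).
- exact: (ev_fiber e pX cT a escP).
- exact: (fiber_phi pX cT aP escP).
- move=> c c' t t' y w w' tg evc evc'.
  have tail c1 t1 : T (6 * 1)%N (ev T e a esc c1 t1 - psum (term T e a esc c1 t1) 1).
    exact: (infsum_tail pX cT (@term_small _ _ e cT a esc escP c1 t1) (ltn0Sn 0)).
  apply: (first_difference pX cT aP escP (ltn0Sn 0) _ _ (tail c t) (tail c' t')).
  + by move=> cc; apply: tg; rewrite cc.
  + by rewrite evc evc'; instantiate (1 := w'); instantiate (1 := w); zmod.
  + by rewrite /psum !big_ord0.
Qed.

End universal_family.

Section lower_bound.
Variables (R : realType) (I : set (set cantor_space)).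
Hypotheses (semi_ideal_I : semi_ideal I) (proper_I : ~ I [set: cantor_space]).
Hypothesis null_I : forall K : set cantor_space, closed K -> haar_cantor R K = 0%E -> I K.
Variable X : topologicalZmodType.
Hypotheses (polish_X : polish R X) (not_locally_compact_X : ~ locally_compact [set: X]).

(** The preimages under phi of the translates of A have at most one point, and
    singletons are closed and null. *)
Lemma thin_haar_small (phi : cantor_space -> X) (A : set X) : continuous phi ->
  (forall y w w', A (phi w + y) -> A (phi w' + y) -> w = w') -> haar_small I A.
Proof.
move=> cphi thin; exists phi; split=> // x.
have [w hw] : exists w, phi @^-1` [set a + x | a in A] `<=` [set w].
  have [[w [b Ab bw]]|n] := pselect (exists w, (phi @^-1` [set a + x | a in A]) w); last first.
    by exists point => w hw; case: n; exists w.
  exists w => w' [b' Ab' bw'] /=; apply: (thin (- x)).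
    by rewrite -bw' addrK.
  by rewrite -bw addrK.
have [_ sub] := semi_ideal_I; apply: sub hw _; apply: null_I.
  exact: cantor_closed_set1.
exact: haar_cantor_set1.
Qed.

(** Let B A be a Borel hull of A in F, and good A the set of the t for which B A
    contains all the values ev c t.  As fiber t is small for every t, the sets
    good A cover the Cantor space; they are coanalytic.  A good set too large to
    embed in F would be mapped onto the Cantor space by some continuous q, and
    composing with q a witness f of the smallness of B A would give a map ev c
    whose values on good A trace a full translate of the image of f in B A. *)
Lemma cofinal_card_ge (F : set (set X)) : cofinal_in (@haar_family X I) F ->
  exists2 h : R -> set X, (forall r, F (h r)) & injective h.
Proof.
move=> [FH Fcof].
have [ev [tag [phi [fiber cat]]]] := catalogue_exists polish_X not_locally_compact_X.
pose V := {A | F A}.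
have /choice[B BP] : forall A : V, exists B, [/\ borel B, haar_small I B & sval A `<=` B].
  by move=> [A FA]; exact: FH.
have /choice[f fP] : forall A : V, exists f : cantor_space -> X, continuous f /\
    forall x, exists u, ~ B A (f u + x).
  move=> A; have [_ [f [cf fI]] _] := BP A; exists f; split=> // x.
  apply: contrapT => /forallNP h; apply: proper_I.
  have [_ sub] := semi_ideal_I; apply: sub (fI (- x)) => u _.
  by exists (f u + x); [exact: contrapT (h u)|rewrite addrK].
have cofA Z : borel Z -> haar_small I Z -> exists A : V, Z `<=` B A.
  move=> bZ hZ; have [|A FA ZA] := Fcof Z; first by exists Z; split=> //; exact: subset_refl.
  exists (exist _ A FA); apply: subset_trans ZA _.
  by have [_ _] := BP (exist _ A FA).
(* If F were countable, one point outside each B A, taken on maps with distinct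
   tags, would form a small set contained in no B A. *)
have V_uncountable : ~ countable [set: V].
  move=> /countable_injP[g gI].
  have /choice[z zP] : forall A : V, exists z, ~ B A z /\
      exists c t, tag (c 0%N) = g A /\ z = ev c t.
    move=> A; have [cf fA] := fP A; have [c [x [tc cx]]] := cat_universal cat (g A) cf.
    by have [u hu] := fA x; exists (ev c u); split; [rewrite cx|exists c, u].
  have [||A ZA] := cofA (range z).
  - rewrite (_ : range z = \bigcup_n [set x | exists2 A, g A = n & z A = x]); last first.
      by apply/seteqP; split=> [_ [A _ <-]|x [n _ [A _ <-]]]; [exists (g A) => //; exists A|exists A].
    apply: borel_bigcup => n; have [[A gA]|nA] := pselect (exists A, g A = n); last first.
      rewrite (_ : [set x | _] = set0); first by apply: borel_closed; exact: closed0.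
      by rewrite -subset0 => x [A gA _]; apply: nA; exists A.
    rewrite (_ : [set x | _] = [set z A]); last first.
      apply/seteqP; split=> [x [A' gA' <-]|x ->]; last by exists A.
      by congr z; apply: gI; rewrite ?inE // gA' gA.
    apply: borel_closed => x zx; apply/esym/eqP; rewrite -subr_eq0; apply/eqP.
    apply: (polish_separated polish_X) => U U0.
    have [_ [-> /=]] := zx _ (translate_nbhs x U0); exact.
  - apply: (thin_haar_small (cat_phi cat)) => y w w' [A _ zA] [A' _ zA'].
    have [_ [c [t [tc ec]]]] := zP A; have [_ [c' [t' [tc' ec']]]] := zP A'.
    have [AA|nAA] := pselect (A = A').
      apply: (cat_thin cat (t := t) (y := y)); rewrite -?zA -?zA' -?AA ec; exact: (cat_fiber cat).
    exfalso; apply: (cat_apart cat (c := c) (c' := c') (t := t) (t' := t') (y := y) (w := w) (w' := w')).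
    + by rewrite tc tc' => e0; apply: nAA; apply: gI; rewrite ?inE.
    + by rewrite -ec.
    + by rewrite -ec'.
  - by have [nB _] := zP A; apply: nB; apply: ZA; exists A.
pose good A : set (nat -> bool) := [set t | forall c, B A (ev c t)].
have good_small A : embeds (good A) V.
  have [bB _ _] := BP A; have [_ [E [E_closed EP]]] := borel_analytic polish_X bB.
  (* Even entries of b describe c, odd entries witness that ev c t is not in B A. *)
  pose S (t : nat -> bool) (b : nat -> nat) := E (ev (fun i => b i.*2) t) (fun i => b i.*2.+1).
  have S_closed : seq_closed S.
    move=> t b h; apply: E_closed => n U /nbhs_translate U0.
    have [m hm] := cat_ev cat (fun i => b i.*2) t U0.
    have [t' [b' [tt bb Sb]]] := h (maxn n m).*2.
    exists (ev (fun i => b' i.*2) t'), (fun i => b' i.*2.+1); split=> //.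
    - have /= := hm (fun i => b' i.*2) t' _ _; rewrite addrCA subrr addr0; apply.
        by move=> i im; apply: bb; lia.
      by move=> i im; apply: tt; lia.
    - by move=> i im; apply: bb; lia.
  have goodS t : good A t <-> forall b, ~ S t b.
    split=> [gt b Sb|nS c].
      have [_ h] := EP (ev (fun i => b i.*2) t); apply: (h _ (gt _)).
      by exists (fun i => b i.*2.+1).
    apply: contrapT => /EP[b Eb].
    apply: (nS (fun i => if odd i then b i./2 else c i./2)); rewrite /S /=.
    rewrite (_ : (fun i => _) = c); last by apply/funext => i; rewrite odd_double doubleK.
    rewrite (_ : (fun i => _) = b) //; apply/funext => i.
    by rewrite odd_double /= uphalf_double.
  apply: contrapT => nemb.
  have [|q [qc qs]] := coanalytic_perfect_set V_uncountable S_closed.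
    by move=> emb; apply: nemb; apply: embeds_sub emb => t /goodS.
  have [cf fA] := fP A.
  have cpsi : continuous (f A \o q : cantor_space -> X).
    apply: (@agree_continuous X) => t U U0.
    have [n hn] := cylinder_nbhs (cf (q t) _ (translate_nbhs _ U0)).
    have [m hm] := qc n; exists m => t' tt'; apply: hn => i ni /=.
    by rewrite (hm _ _ tt').
  have [c [x [_ cx]]] := cat_universal cat 0%N cpsi.
  have [u hu] := fA x; have [t /goodS gt qt] := qs u.
  by apply: hu; rewrite -qt; have := gt c; rewrite cx.
have [j ji] : exists j : nat -> V, injective j by exact: uncountable_nat_embedding.
have [g gI] : embeds [set: nat -> bool] V.
  apply: (@embeds_sub _ _ _ (\bigcup_A good A)); last exact: (embeds_bigcup ji (@inj_id V)).
  move=> t _; have [||A hA] := cofA (fiber t); first exact: cat_borel cat t.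
    by apply: (thin_haar_small (cat_phi cat)) => y w w'; exact: (cat_thin cat).
  by exists A => // c; apply: hA; exact: (cat_fiber cat).
have [r rI] := real_to_cantor R.
exists (fun x => sval (g (r x))); first by move=> x; exact: svalP.
by move=> x y /eq_sig_hprop e0; apply: rI; apply: gI => //; apply: e0 => ? ? ?; exact: Prop_irrelevance.
Qed.

End lower_bound.

Theorem theorem14p4 (R : realType) (I : set (set cantor_space))
    (semi_ideal_I : semi_ideal I)
    (proper_I : ~ I [set: cantor_space])
    (null_I : forall K : set cantor_space,
       closed K -> haar_cantor R K = 0%E -> I K)
    (X : topologicalZmodType)
    (polish_X : polish R X)
    (not_locally_compact_X : ~ locally_compact [set: X]) :
  cof_eq (@haar_family X I) [set: R].
Proof.
have lower F : cofinal_in (@haar_family X I) F -> ([set: R] #<= F)%card.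
  move=> /(cofinal_card_ge semi_ideal_I proper_I null_I polish_X not_locally_compact_X)[h hF hI].
  apply/pcard_leP; apply/injfunPex; exists h; first by move=> r _; exact: hF.
  by move=> x y _ _; exact: hI.
split=> //; pose F := [set B | borel B /\ haar_small I B] : set (set X).
have cF : cofinal_in (@haar_family X I) F.
  split=> [B [bB hB]|A [B [bB hB AB]]]; last by exists B.
  by exists B; split=> //; exact: subset_refl.
exists F; split=> //; apply/card_eqPle; split; last exact: lower.
have [f fI] := borel_embeds polish_X.
apply/pcard_injP; exists f => A B; rewrite !inE => -[bA _] [bB _]; exact: fI.
Qed.
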